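(* Let $d\ge2$ be a constant and $\phi\ge1$. Starting with an arbitrary tour, the expected number of steps performed by 2-Opt on $\phi$-perturbed Euclidean instances with $n$ vertices is $O(n^7\cdot\log^2(n)\cdot\phi^3)$.
   Context: A $\phi$-perturbed Euclidean instance: vertices $v_1,\ldots,v_n$ are placed independently in $[0,1]^d$, vertex $v_i$ according to a density $f_i\colon[0,1]^d\to[0,\phi]$, with $L_2$ distances. 2-Opt repeatedly performs improving 2-changes (replace tour edges $\{u_1,u_2\},\{v_1,v_2\}$, with $u_1,u_2,v_1,v_2$ distinct and in this order along the tour, by $\{u_1,v_1\},\{u_2,v_2\}$, provided the tour length strictly decreases) until none exists; the bound holds for any initial tour and any choice of improving steps. $O$-notation hides constants depending on $d$. *)

(* Defs.v *)
From HB Require Import structures.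
From mathcomp Require Import all_boot all_order all_algebra.
From mathcomp Require Import all_classical all_reals all_analysis.

Set Implicit Arguments.
Unset Strict Implicit.
Unset Printing Implicit Defensive.

Import Order.TTheory GRing.Theory Num.Theory.
Import numFieldNormedType.Exports.

Local Open Scope classical_set_scope.
Local Open Scope ring_scope.

(* The product sigma-algebra on tuples over [measurableTypeR R] is the Borel
   sigma-algebra of R^d. *)
Notation Rpoint R d := (d.-tuple (measurableTypeR R)).

Section lebesgue_tuple.
Context {R : realType}.

Definition pcons d (z : measurableTypeR R * Rpoint R d) : Rpoint R d.+1 :=
  [tuple of z.1 :: z.2].

Lemma measurable_pcons d : measurable_fun [set: _] (@pcons d).
Proof. exact: measurable_cons. Qed.

Section lebesgue_cons.
Variables (d : nat) (mu : {sigma_finite_measure set (Rpoint R d) -> \bar R}).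

Definition lebesgue_cons : set (Rpoint R d.+1) -> \bar R :=
  pushforward (@lebesgue_measure R \x mu)%E (@pcons d).

Let lebesgue_cons0 : lebesgue_cons set0 = 0%E.
Proof. by rewrite /lebesgue_cons /pushforward preimage_set0 measure0. Qed.

Let lebesgue_cons_ge0 A : (0 <= lebesgue_cons A)%E.
Proof. exact: (measure_ge0 (@lebesgue_measure R \x mu)%E). Qed.

Let lebesgue_cons_sigma_additive : semi_sigma_additive lebesgue_cons.
Proof.
exact: (@measure_semi_sigma_additive _ _ _
  (measure_function_pushforward__canonical__measure_function_Measure
     (@lebesgue_measure R \x mu)%E (@measurable_pcons d))).
Qed.

HB.instance Definition _ := isMeasure.Build _ _ _ lebesgue_cons
  lebesgue_cons0 lebesgue_cons_ge0 lebesgue_cons_sigma_additive.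

Let lebesgue_cons_sigma_finite : sigma_finite [set: Rpoint R d.+1] lebesgue_cons.
Proof.
have /sigma_finiteP[F [TF ndF Foo]] := sigma_finiteT (@lebesgue_measure R).
have /sigma_finiteP[G [TG ndG Goo]] := sigma_finiteT mu.
pose uncons (t : Rpoint R d.+1) : measurableTypeR R * Rpoint R d :=
  (tnth t ord0, [tuple of behead t]).
have unconsK : cancel (@pcons d) uncons.
  by move=> [x t]; congr pair; apply/val_inj.
have muncons : measurable_fun [set: _] uncons.
  apply: measurable_fun_pair; first exact: measurable_tnth.
  exact: measurable_behead.
exists (fun k => uncons @^-1` (F k `*` G k)).
  rewrite -preimage_bigcup; apply/esym/seteqP; split => // t _.
  have [i _ Fi] : (\bigcup_i F i) (uncons t).1 by rewrite -TF.
  have [j _ Gj] : (\bigcup_i G i) (uncons t).2 by rewrite -TG.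
  exists (maxn i j) => //; split.
  - by move: Fi; exact/subsetPset/ndF/leq_maxl.
  - by move: Gj; exact/subsetPset/ndG/leq_maxr.
move=> k; have [mFk Fkoo] := Foo k; have [mGk Gkoo] := Goo k; split.
  by rewrite -[X in measurable X]setTI; apply: muncons => //; exact: measurableX.
rewrite /lebesgue_cons /pushforward -comp_preimage.
rewrite (_ : uncons \o _ = id) ?preimage_id; last exact/funext.
by rewrite product_measure1E// lte_mul_pinfty// ge0_fin_numE.
Qed.

HB.instance Definition _ := Measure_isSigmaFinite.Build _ _ _ lebesgue_cons
  lebesgue_cons_sigma_finite.

End lebesgue_cons.

(* d-dimensional Lebesgue measure on the Borel sets of R^d, as the iterated
   product of the one-dimensional one; R^0 carries the unit mass. *)
Fixpoint lebesgue_tuple d : {sigma_finite_measure set (Rpoint R d) -> \bar R} :=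
  if d is d'.+1 then lebesgue_cons (lebesgue_tuple d') else \d_[tuple].

End lebesgue_tuple.

Section two_opt.
Context {R : realType} {n d : nat}.

Definition dist2 (p q : Rpoint R d) : R :=
  Num.sqrt (\sum_(j < d) ((tnth p j : R) - tnth q j) ^+ 2).

(* A tour lists the n vertices in visiting order; it is read cyclically, so
   [next t u] is the vertex visited after u. *)
Record tour : Type := Tour {
  tour_tuple :> n.-tuple 'I_n;
  tour_uniq : uniq tour_tuple }.

Definition tour_edges (t : tour) : {set {set 'I_n}} :=
  [set [set u; next t u] | u : 'I_n]%SET.

Definition tour_length (x : 'I_n -> Rpoint R d) (t : tour) : R :=
  \sum_(u < n) dist2 (x u) (x (next t u)).

(* For distinct vertices with [next t u1 = u2] and [next t v1 = v2], the order
   along t is u1, u2, v1, v2.  As t' is constrained only through its set of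
   edges, nothing depends on the starting point or the orientation of its
   visiting order. *)
Definition two_change (t t' : tour) : bool :=
  [exists u1, exists u2, exists v1, exists v2,
    [&& uniq [:: u1; u2; v1; v2], next t u1 == u2, next t v1 == v2 &
        tour_edges t' ==
          tour_edges t :\: [set [set u1; u2]; [set v1; v2]]
            :|: [set [set u1; v1]; [set u2; v2]]]]%SET.

Definition improving (x : 'I_n -> Rpoint R d) : rel tour :=
  fun t t' => two_change t t' && (tour_length x t' < tour_length x t).

Definition locally_optimal (x : 'I_n -> Rpoint R d) (t : tour) : Prop :=
  forall t', ~~ improving x t t'.

(* r lists the tours visited after t, so the run performs [size r] steps. *)
Definition two_opt_run (x : 'I_n -> Rpoint R d) (t : tour) (r : seq tour) : Prop :=
  path (improving x) t r /\ locally_optimal x (last t r).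

(* Worst case over the initial tour and over all choices of improving steps. *)
Definition two_opt_steps (x : 'I_n -> Rpoint R d) : \bar R :=
  ereal_sup [set s | exists t r, two_opt_run x t r /\ s = (size r)%:R%:E].

End two_opt.

Section perturbed.
Context {R : realType} {n d : nat} {disp : measure_display}
  {Omega : measurableType disp} (P : probability Omega R).

Definition unit_cube : set (Rpoint R d) :=
  [set p | forall j, 0 <= (tnth p j : R) <= 1].

Definition mutually_independent (X : 'I_n -> {RV P >-> Rpoint R d}) : Prop :=
  forall (J : {set 'I_n}) (A : 'I_n -> set (Rpoint R d)),
    (forall i, measurable (A i)) ->
    P (\bigcap_(i in [set` J]) (X i @^-1` A i)) =
    (\prod_(i in J) P (X i @^-1` A i))%E.

Definition has_density (X : {RV P >-> Rpoint R d}) (f : Rpoint R d -> R) : Prop :=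
  forall A, measurable A ->
    distribution P X A =
    (\int[lebesgue_tuple d]_(p in A `&` unit_cube) (f p)%:E)%E.

(* The values of f i outside the unit cube are irrelevant. *)
Definition perturbed_instance (phi : R) (f : 'I_n -> Rpoint R d -> R)
    (X : 'I_n -> {RV P >-> Rpoint R d}) : Prop :=
  [/\ forall i, measurable_fun unit_cube (f i : _ -> measurableTypeR R),
      forall i p, unit_cube p -> 0 <= f i p <= phi,
      forall i, has_density (X i) (f i) &
      mutually_independent X].

End perturbed.

(* Main.v *)
(* A 2-change on u1, u2, v1, v2 gains F(u1) - F(v2), where
   F(x) = |x - u2| - |x - v1|.  Fix u2 and v1, freeze all but the first two
   coordinates of x, and let rho be the distance between the projections of u2 and
   v1 to the remaining plane.  Along a line of this plane orthogonal to u2 - v1,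
   |x - u2|^2 - |x - v1|^2 is constant and F is monotone on either side of the foot
   of u2, with slope controlled by an explicit weight V(x).  Level sets of F of
   width eps meet {V >= m} in measure O(eps / (rho m)), and {V <= v} has measure
   O(v).  If V(u1) <= V(v2) and the gain is in (0, eps], then v2 lies in a level
   set inside {V >= V(u1)}; integrating 1 / V(u1) over u1 bounds the probability of
   such a gain by O(phi^2 eps log(1/eps) / rho), and averaging over u2 removes
   1 / rho at the cost of one more factor phi.  A run with k steps starts at length
   at most L = n sqrt(d), so for every t <= k some 2-change gains at most L / t.
   Summing over the n^4 quadruples and over t <= n^n, which bounds the number of
   steps, gives n^5 phi^3 log(n^n)^2. *)

Require Import Defs.
From HB Require Import structures.
From mathcomp Require Import all_boot all_order all_algebra.
From mathcomp Require Import all_classical all_reals all_analysis.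
From mathcomp Require Import measurable_realfun ring lra.

Set Implicit Arguments.
Unset Strict Implicit.
Unset Printing Implicit Defensive.

Import Order.TTheory GRing.Theory Num.Theory.
Import numFieldNormedType.Exports.

Local Open Scope classical_set_scope.
Local Open Scope ring_scope.

(** * Integrals and product measures *)

Lemma measurable_preimage (d1 d2 : measure_display) (T1 : measurableType d1)
    (T2 : measurableType d2) (f : T1 -> T2) (A : set T2) :
  measurable_fun setT f -> measurable A -> measurable (f @^-1` A).
Proof. by move=> mf mA; rewrite -[_ @^-1` _]setTI; exact: mf. Qed.

Section measurable_real_functions.
Context {R : realType}.

Lemma measurable_sqrtr : measurable_fun [set: R] (@Num.sqrt R).
Proof. by apply: continuous_measurable_fun; exact: sqrt_continuous. Qed.

Lemma measurable_invr : measurable_fun [set: R] (fun x : R => x^-1).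
Proof.
under eq_fun => x.
  rewrite (_ : x^-1 = x * (`|x| `^ (- 1)) ^+ 2); last first.
    rewrite powR_inv1// exprVn real_normK ?num_real//.
    have [->|x0] := eqVneq x 0; first by rewrite invr0 mul0r.
    by rewrite expr2 invfM mulrA divff// mul1r.
  over.
apply: measurable_funM => //; apply: measurable_funX.
apply: (measurableT_comp (measurable_powR _)); exact: normr_measurable.
Qed.

Lemma measurable_inve : measurable_fun [set: R] (fun x : R => x%:E^-1%E).
Proof.
under eq_fun do rewrite inver.
apply: measurable_fun_ifT => //; first exact: measurable_fun_eqr.
by apply/measurable_EFinP; exact: measurable_invr.
Qed.

End measurable_real_functions.

Section nonneg_integral.
Local Open Scope ereal_scope.
Context {disp : measure_display} {T : measurableType disp} {R : realType}.
Implicit Types (mu nu : {measure set T -> \bar R}) (f g : T -> \bar R).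

(* Integrals of nonnegative functions are suprema over simple functions, hence
   monotone even for nonmeasurable integrands. *)
Lemma nonneg_le_integral mu (D : set T) f g : (forall x, D x -> 0 <= f x) ->
  (forall x, D x -> f x <= g x) ->
  \int[mu]_(x in D) f x <= \int[mu]_(x in D) g x.
Proof.
move=> f0 fg; have g0 x : D x -> 0 <= g x by move=> Dx; exact: le_trans (f0 x Dx) (fg x Dx).
rewrite !ge0_integralE//; apply: ge_ereal_sup => _ [h /= hf <-].
apply: ereal_sup_ubound; exists h => // x; apply: le_trans (hf x) _.
by rewrite !patchE; case: ifPn => // /set_mem/fg.
Qed.

Lemma le_nonneg_integral mu (D : set T) f g : (forall x, D x -> 0 <= g x) ->
  (forall x, D x -> f x <= g x) ->
  \int[mu]_(x in D) f x <= \int[mu]_(x in D) g x.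
Proof.
move=> g0 fg; rewrite integralE.
apply: (@le_trans _ _ (\int[mu]_(x in D) f^\+ x)).
  by rewrite -[leRHS]sube0 leeD2l// leeN2 integral_ge0.
by apply: nonneg_le_integral => // x Dx; rewrite funeposE ge_max fg//= g0.
Qed.

Lemma ae_le_nonneg_integral mu f g : measurable_fun setT g -> (forall x, 0 <= g x) ->
  {ae mu, forall x, f x <= g x} -> \int[mu]_x f x <= \int[mu]_x g x.
Proof.
move=> mg g0 [N [mN muN f_le]].
have mindicN : measurable_fun setT (fun x => (\1_N x : R)%:E).
  exact/measurable_EFinP/measurable_indic.
apply: (@le_trans _ _ (\int[mu]_x (g x + +oo * (\1_N x)%:E))).
  apply: le_nonneg_integral => x _; first by rewrite adde_ge0.
  have [Nx|/(contra_not (f_le x))/contrapT fg] := pselect (N x); last first.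
    by apply: le_trans fg _; exact: leeDl.
  by rewrite indicE mem_set// mule1 addey ?leey// gt_eqF// (lt_le_trans _ (g0 x)).
rewrite ge0_integralD//; last exact: measurable_funeM.
by rewrite ge0_integralZl// integral_indic// setIT muN mule0 adde0.
Qed.

Lemma integral_le_sum_measure mu (I : Type) (s : seq I) (A : I -> set T) f :
  (forall i, measurable (A i)) ->
  {ae mu, forall x, f x <= \sum_(i <- s) (\1_(A i) x)%:E} ->
  \int[mu]_x f x <= \sum_(i <- s) mu (A i).
Proof.
move=> mA f_le.
have mindic i : measurable_fun setT (fun x => (\1_(A i) x : R)%:E).
  exact/measurable_EFinP/measurable_indic.
apply: le_trans (ae_le_nonneg_integral _ _ f_le) _.
- exact: emeasurable_sum.
- by move=> x; exact: sume_ge0.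
by rewrite ge0_integral_sum//; apply: lee_sum => i _; rewrite integral_indic// setIT.
Qed.

Lemma nonneg_integral_le_cst mu (D : set T) f (M : \bar R) : measurable D ->
  (forall x, D x -> 0 <= f x <= M) -> \int[mu]_(x in D) f x <= M * mu D.
Proof.
move=> mD fM; rewrite -integral_cst//.
by apply: nonneg_le_integral => x /fM/andP[].
Qed.

Lemma integral_support mu (D : set T) f : (forall x, ~ D x -> f x = 0) ->
  \int[mu]_x f x = \int[mu]_(x in D) f x.
Proof.
move=> fD; rewrite [RHS]integral_mkcond; congr integral.
by apply/funext => x; rewrite patchE; case: ifPn => // /negP; rewrite inE => /fD.
Qed.

Lemma nonneg_integral_dominated_le mu nu (D : set T) (k : R) f : measurable D ->
  (0 <= k)%R -> (forall A, measurable A -> mu A <= k%:E * nu A) ->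
  measurable_fun setT f -> (forall x, 0 <= f x) ->
  \int[mu]_(x in D) f x <= k%:E * \int[nu]_(x in D) f x.
Proof.
move=> mD k0 munu mf f0.
rewrite -(@ge0_integral_mscale _ _ _ _ D _ (NngNum k0))//; last exact: measurable_funTS.
exact: ge0_le_measure_integral.
Qed.

End nonneg_integral.

Section product_measure.
Local Open Scope ereal_scope.
Context {d1 d2 : measure_display} {T1 : measurableType d1}
  {T2 : measurableType d2} {R : realType}.

Lemma product_measure_swap (m1 : {sigma_finite_measure set T1 -> \bar R})
    (m2 : {sigma_finite_measure set T2 -> \bar R}) (A : set (T1 * T2)) :
  measurable A -> (m1 \x m2) A = (m2 \x m1) [set z | A (z.2, z.1)].
Proof.
move=> mA; transitivity ((m1 \x^ m2) A).
  by apply: product_measure_unique => //= B C mB mC; rewrite product_measure2E.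
exact: eq_integral.
Qed.

Lemma product_measure_dominated_le (m1 n1 : {measure set T1 -> \bar R})
    (m2 n2 : {sigma_finite_measure set T2 -> \bar R}) (k1 k2 : R) :
  (0 <= k1)%R -> (0 <= k2)%R ->
  (forall A, measurable A -> m1 A <= k1%:E * n1 A) ->
  (forall A, measurable A -> m2 A <= k2%:E * n2 A) ->
  forall S, measurable S -> (m1 \x m2) S <= (k1 * k2)%:E * (n1 \x n2) S.
Proof.
move=> k10 k20 mn1 mn2 S mS.
have mxS : measurable_fun setT (fun x => n2 (xsection S x)).
  exact: measurable_fun_xsection.
apply: (@le_trans _ _ (\int[m1]_x (k2%:E * n2 (xsection S x)))).
  by apply: nonneg_le_integral => x _ //=; apply: mn2; exact: measurable_xsection.
rewrite ge0_integralZl// mulrC EFinM -muleA lee_wpmul2l ?lee_fin//.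
exact: nonneg_integral_dominated_le.
Qed.

End product_measure.

Section law_given.
Local Open Scope ereal_scope.
Context {disp : measure_display} {Omega : measurableType disp} {R : realType}
  (P : probability Omega R).

(* Z has law m and is independent of the event G. *)
Definition law_given (G : set Omega) (d1 : measure_display)
    (T1 : measurableType d1) (Z : Omega -> T1) (m : set T1 -> \bar R) : Prop :=
  forall E, measurable E -> P (Z @^-1` E `&` G) = m E * P G.

Lemma law_given_pair (G : set Omega) (d1 d2 : measure_display)
    (T1 : measurableType d1) (T2 : measurableType d2)
    (m1 : probability T1 R) (m2 : probability T2 R)
    (Y : Omega -> T1) (Z : Omega -> T2) :
  measurable G -> measurable_fun setT Y -> measurable_fun setT Z ->
  law_given G Y m1 ->
  (forall B, measurable B -> law_given (Y @^-1` B `&` G) Z m2) ->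
  law_given G (fun w => (Y w, Z w)) (m1 \x m2).
Proof.
move=> mG mY mZ YG ZG E mE.
have mYZ : measurable_fun setT (fun w => (Y w, Z w)) by exact: measurable_fun_pair.
have PG0 : (0 <= fine (P G))%R by rewrite fine_ge0// measure_ge0.
have PGE : P G = (fine (P G))%:E by rewrite fineK// fin_num_measure.
pose nu := measure_function_pushforward__canonical__measure_function_Measure
  (mrestr P mG) mYZ.
rewrite -[LHS]/(nu E) -(product_measure_unique (m1 := mscale (NngNum PG0) m1) (m2 := m2))//.
  rewrite /product_measure1 ge0_integral_mscale//=; last first.
    exact: measurable_fun_xsection.
  by rewrite -PGE muleC.
move=> B C mB mC; rewrite /nu /= /pushforward /mrestr /mscale /= -PGE.
rewrite (_ : _ `&` G = Z @^-1` C `&` (Y @^-1` B `&` G)).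
  by rewrite ZG// YG// [m1 B * _]muleC muleC.
by rewrite setIA [_ @^-1` C `&` _]setIC.
Qed.

End law_given.

(** * Layer-cake bounds along the harmonic sequence *)

Section harmonic_layers.
Context {R : realType}.
Implicit Types (w : R) (J : nat).

Lemma series_harmonic_ge0 J : 0 <= series (@harmonic R) J.
Proof. by apply: sumr_ge0 => j _; exact: harmonic_ge0. Qed.

Lemma harmonicS_le_lnB J : harmonic J.+1 <= ln J.+2%:R - ln J.+1%:R :> R.
Proof.
have -> : ln J.+2%:R - ln J.+1%:R = - ln (1 - harmonic J.+1) :> R.
  rewrite -[LHS]opprB -ln_div ?posrE ?ltr0n//; congr (- ln _).
  by rewrite /= -[J.+1%:R](addrK 1) natr1 mulrBl mul1r divff ?pnatr_eq0.
rewrite lerNr; apply: le_ln1Dx; rewrite ltrN2 /=.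
by rewrite invf_lt1 ?ltr0n// ltr1n.
Qed.

Lemma series_harmonic_le_ln J : (0 < J)%N -> series (@harmonic R) J <= 1 + ln J%:R.
Proof.
case: J => // J _; elim: J => [|J IH].
  by rewrite /series /= big_nat1 ln1 addr0 invr1.
rewrite /series /= big_nat_recr//=; apply: le_trans (lerD IH (harmonicS_le_lnB J)) _.
by rewrite -addrA lerD2l addrC subrK.
Qed.

Lemma sum_harmonic_sqr_le J : \sum_(j < J) harmonic j ^+ 2 <= 2 :> R.
Proof.
suff sumS : \sum_(j < J.+1) harmonic j ^+ 2 <= 2 - harmonic J :> R.
  apply: le_trans (le_trans sumS _); last by rewrite gerBl harmonic_ge0.
  by rewrite big_ord_recr lerDl sqr_ge0.
elim: J => [|J IH]; first by rewrite big_ord_recl big_ord0 /= invr1; lra.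
rewrite big_ord_recr; apply: le_trans (lerD IH (lexx _)) _ => /=.
have J1 : 0 < J.+1%:R :> R by rewrite ltr0n.
rewrite -[J.+2%:R]natr1; move: (J.+1%:R : R) J1 => t t0.
rewrite -subr_ge0 (_ : _ - _ = (t * (t + 1) ^+ 2)^-1).
  by rewrite invr_ge0 mulr_ge0 ?sqr_ge0 ?ltW.
by field; rewrite !lt0r_neq0//; lra.
Qed.

Lemma inve_le_harmonic_layers w : 0 <= w ->
  (w%:E^-1 <= 1 + \sum_(0 <= j <oo) ((w <= harmonic j)%R%:R : R)%:E)%E.
Proof.
move=> w0; set S := (\sum_(0 <= j <oo) _)%E.
have layersS m : w * m%:R <= 1 -> (m%:R%:E <= S)%E.
  move=> wm; apply: le_trans (nneseries_lim_ge m _) => //.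
  rewrite sumEFin lee_fin -[m in leLHS]subn0 -[leLHS]sumr_const_nat.
  rewrite !big_nat; apply: ler_sum => j /= jm; rewrite -[_^-1]div1r.
  by rewrite ler_pdivlMr ?ltr0n// (le_trans _ wm)// ler_wpM2l// ler_nat.
have [w_eq0|w_neq0] := eqVneq w 0.
  suff -> : S = +oo%E by rewrite addey// leey.
  apply/eqyP => A A0; apply: le_trans (layersS (Num.truncn A).+1 _).
    by rewrite lee_fin ltW// truncnS_gt.
  by rewrite w_eq0 mul0r.
have winv0 : 0 <= w^-1 by rewrite invr_ge0.
have /andP[mw wm] := truncn_itv winv0.
rewrite inver (negbTE w_neq0).
apply: (@le_trans _ _ (1 + (Num.truncn w^-1)%:R%:E)%E).
  by rewrite -EFinD lee_fin nat1r ltW.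
by rewrite leeD2l// layersS// mulrC -ler_pdivlMr ?div1r// lt0r w_neq0.
Qed.

End harmonic_layers.

Section integral_inve.
Context {disp : measure_display} {T : measurableType disp} {R : realType}.
Variables (mu : {measure set T -> \bar R}) (D : set T) (W : T -> R) (c : R).
Hypotheses (mD : measurable D) (mW : measurable_fun setT W).
Hypotheses (W0 : forall x, 0 <= W x) (c0 : 0 <= c).

Lemma integral_inve_le_layers :
  (\int[mu]_(x in D) (W x)%:E^-1 <=
   mu D + \sum_(0 <= j <oo) mu (D `&` [set x | W x <= harmonic j]%R))%E.
Proof.
pose layer j : set T := [set x | W x <= harmonic j].
have mlayer j : measurable (layer j).
  by rewrite -[layer j]setTI; exact: measurable_fun_le.
have m1layer j : measurable_fun D (fun x => (\1_(layer j) x)%:E : \bar R).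
  exact/measurable_EFinP/measurable_indic.
apply: (@le_trans _ _
    (\int[mu]_(x in D) (1 + \sum_(0 <= j <oo) (\1_(layer j) x)%:E))%E).
  apply: nonneg_le_integral => x _; first by rewrite inve_ge0 lee_fin.
  apply: le_trans (inve_le_harmonic_layers (W0 x)) _.
  by rewrite leeD2l//; apply: lee_nneseries => // j _; rewrite indicE mem_setE.
rewrite ge0_integralD//; last 2 first.
  by move=> x _; rewrite nneseries_ge0.
  exact: ge0_emeasurable_sum.
rewrite integral_cst// mul1e leeD2l// integral_nneseries//.
by apply: lee_nneseries => // j _; rewrite integral_indic// setIC.
Qed.

Lemma integral_inve_le_sqr :
  (forall v : R, 0 < v -> (mu (D `&` [set x | W x <= v]%R) <= (c * v ^+ 2)%:E)%E) ->
  (\int[mu]_(x in D) (W x)%:E^-1 <= mu D + (2 * c)%:E)%E.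
Proof.
move=> DW; apply: le_trans integral_inve_le_layers _; rewrite leeD2l//.
apply: lime_le; first exact: is_cvg_nneseries.
apply: nearW => J; apply: (@le_trans _ _ (\sum_(j < J) (c * harmonic j ^+ 2)%:E)%E).
  by rewrite big_mkord; apply: lee_sum => j _; exact/DW/harmonic_gt0.
by rewrite sumEFin lee_fin -mulr_sumr mulrC ler_wpM2r// sum_harmonic_sqr_le.
Qed.

End integral_inve.

Section integral_inve_max.
Context {disp : measure_display} {T : measurableType disp} {R : realType}.
Variables (mu : {measure set T -> \bar R}) (D : set T) (W : T -> R) (c K : R).
Hypotheses (mD : measurable D) (mW : measurable_fun setT W) (K0 : 0 < K).

Lemma integral_inve_max_le_harmonic (J : nat) : 1 <= K * J%:R ->
  (forall v : R, 0 < v -> (mu (D `&` [set x | W x <= v]%R) <= (c * v)%:E)%E) ->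
  (\int[mu]_(x in D) (Num.max K (W x))%:E^-1 <= mu D + (c * series harmonic J)%:E)%E.
Proof.
move=> KJ DW; apply: le_trans (integral_inve_le_layers mu mD _ _) _.
- exact: measurable_maxr.
- by move=> x; rewrite le_max ltW.
rewrite leeD2l// (nneseries_split 0 J)// add0n eseries0; last first.
  move=> j Jj _; rewrite (_ : _ `&` _ = set0) ?measure0//.
  apply/seteqP; split => // x [_ /=]; rewrite ge_max => /andP[Kj _].
  suff : K * J%:R < 1 by rewrite ltNge KJ.
  apply: le_lt_trans (_ : j%:R / j.+1%:R < 1).
    by rewrite mulrC ler_pM ?ler_nat// ltW.
  by rewrite ltr_pdivrMr ?ltr0n// mul1r ltr_nat.
rewrite adde0 /series /= mulr_sumr -sumEFin; apply: lee_sum => j _.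
apply: le_trans (DW _ (harmonic_gt0 j)); apply: le_measure; rewrite ?inE.
- by apply: measurable_fun_le => //; apply: measurable_maxr => //; exact: measurable_funTS.
- by apply: measurable_fun_le => //; exact: measurable_funTS.
- by move=> x [Dx]; rewrite /= ge_max => /andP[].
Qed.

End integral_inve_max.

Section small_difference.
Context {disp : measure_display} {T : measurableType disp} {R : realType}.
Variables (mu : {sigma_finite_measure set T -> \bar R}) (D : set T).
Variables (F W : T -> R) (c K eps : R) (J : nat).
Hypotheses (mD : measurable D) (mW : measurable_fun setT W).
Hypotheses (muD : (mu D <= 1)%E) (K0 : 0 < K) (KJ : 1 <= K * J%:R).
Hypothesis sublevel : forall v : R, 0 < v ->
  (mu (D `&` [set x | W x <= v]%R) <= (c * v)%:E)%E.
Hypothesis level : forall (y m : R) (A : set T), measurable A -> A `<=` D ->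
  0 < m -> (forall x, A x -> y <= F x <= y + eps /\ m <= W x) ->
  (mu A <= (K / m)%:E)%E.

Lemma product_level_increasing_weight_le (y : T -> R) (E : set (T * T)) :
  measurable E ->
  (forall z, E z -> [/\ D z.1, D z.2, y z.1 <= F z.2 <= y z.1 + eps &
     W z.1 <= W z.2]) ->
  ((mu \x mu) E <= (K * (1 + c * series harmonic J))%:E)%E.
Proof.
move=> mE Esub; rewrite /product_measure1 (integral_support mu (D := D)); last first.
  move=> x nDx /=; rewrite (_ : xsection E x = set0) ?measure0//.
  by apply/seteqP; split => // z /xsectionP/Esub[].
apply: (@le_trans _ _ (\int[mu]_(x in D) (K%:E * (Num.max K (W x))%:E^-1))%E).
  apply: nonneg_le_integral => // x Dx /=.
  have mEx : measurable (xsection E x) by exact: measurable_xsection.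
  have ExD : xsection E x `<=` D by move=> z /xsectionP/Esub[].
  have [WK|KW] := leP (W x) K.
    by rewrite divee ?gt_eqF// (le_trans _ muD)// le_measure ?inE.
  have W0 := lt_trans K0 KW; rewrite inver gt_eqF// -EFinM.
  by apply: (level (y := y x)) => // z /xsectionP/Esub[].
rewrite ge0_integralZl//; last 3 first.
- apply: measurable_funTS; apply: (measurableT_comp measurable_inve).
  exact: measurable_maxr.
- by move=> x _; rewrite inve_ge0 lee_fin le_max ltW.
- by rewrite lee_fin ltW.
rewrite EFinM lee_wpmul2l ?lee_fin ?(ltW K0)// EFinD.
exact: le_trans (integral_inve_max_le_harmonic mD mW K0 KJ sublevel) (leeD2r _ muD).
Qed.

Lemma product_small_difference_le (E : set (T * T)) : measurable E ->
  (forall z, E z -> [/\ D z.1, D z.2 & 0 <= F z.1 - F z.2 <= eps]) ->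
  ((mu \x mu) E <= (2 * K * (1 + c * series harmonic J))%:E)%E.
Proof.
move=> mE Esub.
have mW1 : measurable_fun setT (fun z : T * T => W z.1) by exact: measurableT_comp.
have mW2 : measurable_fun setT (fun z : T * T => W z.2) by exact: measurableT_comp.
pose E1 := E `&` [set z | W z.1 <= W z.2].
pose E2 := E `&` [set z | W z.2 <= W z.1].
have mE1 : measurable E1 by apply: measurable_fun_le => //; exact: measurable_funTS.
have mE2 : measurable E2 by apply: measurable_fun_le => //; exact: measurable_funTS.
have -> : E = E1 `|` E2.
  by rewrite -setIUr; apply/esym/setIidPl => z _; exact/orP/le_total.
apply: le_trans (measureU2 _ mE1 mE2) _.
rewrite -mulrA mulr_natl mulr2n EFinD; apply: leeD.
  apply: (product_level_increasing_weight_le (y := fun x => F x - eps)) => //.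
  by move=> z [/Esub[D1 D2 /andP[? ?]] W12]; split => //; apply/andP; split; lra.
rewrite [leLHS]product_measure_swap//.
apply: (product_level_increasing_weight_le (y := F)).
  by apply: measurable_preimage mE2; exact: measurable_fun_pair.
by move=> z [/Esub[D1 D2 /andP[? ?]] W12]; split => //; apply/andP; split; lra.
Qed.

End small_difference.

(** * Lebesgue measure in the plane *)

Section plane_lebesgue.
Context {R : realType}.
Local Notation mR := (measurableTypeR R).
Local Notation leb := (@lebesgue_measure R).

Lemma lebesgue_measure_translation (c : R) (A : set mR) : measurable A ->
  leb [set x | A (x - c)] = leb A.
Proof.
move=> mA.
have mf : measurable_fun [set: mR] (fun x : mR => x - c : mR).
  by apply: measurable_funB => //; exact: measurable_id.
apply/esym; have := @lebesgue_measure_unique R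
  (measure_function_pushforward__canonical__measure_function_Measure leb mf).
apply => // _ [[a b]] _ <-.
rewrite /= /pushforward.
have -> : (fun x : mR => x - c) @^-1` `]a, b] = `]a + c, b + c]%classic.
  by apply/seteqP; split => x /=; rewrite !in_itv/= ltrBrDr lerBlDr.
rewrite !lebesgue_measure_itv/= !lte_fin ltrD2r.
by case: ifP => // _; rewrite -!EFinB; congr EFin; ring.
Qed.

Lemma lebesgue_within_distance_le (E : set mR) (x r : R) : measurable E ->
  0 <= r -> (forall s, E s -> `|s - x| <= r) -> (leb E <= (2 * r)%:E)%E.
Proof.
move=> mE r0 Er; apply: (@le_trans _ _ (leb `[x - r, x + r]%classic)).
  by apply: le_measure; rewrite ?inE// => s /Er; rewrite ler_distl /= in_itv.
rewrite lebesgue_measure_itv/= lte_fin.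
by case: ifP => _; rewrite -?EFinB lee_fin; lra.
Qed.

Lemma lebesgue_distance_oscillation_le (E : set mR) (sigma delta : R) :
  measurable E -> 0 <= delta ->
  (forall s s', E s -> E s' -> `|s' - sigma| - `|s - sigma| <= delta) ->
  (leb E <= (4 * delta)%:E)%E.
Proof.
move=> mE delta0 osc; have [->|/set0P[s0 Es0]] := eqVneq E set0.
  by rewrite measure0 lee_fin mulr_ge0.
pose r := `|s0 - sigma|.
have mEr : measurable (E `&` `[sigma, +oo[) by exact: measurableI.
have mEl : measurable (E `&` `]-oo, sigma]) by exact: measurableI.
rewrite (_ : E = (E `&` `[sigma, +oo[) `|` (E `&` `]-oo, sigma])); last first.
  rewrite -setIUr; apply/esym/setIidPl => s _ /=; rewrite !in_itv/= andbT.
  exact/orP/le_total.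
rewrite (_ : 4 * delta = 2 * delta + 2 * delta); last by ring.
apply: le_trans (measureU2 _ mEr mEl) _; rewrite EFinD; apply: leeD.
  apply: (@lebesgue_within_distance_le _ (sigma + r)) => // s [Es] /=.
  rewrite in_itv/= andbT => sigma_s; have := osc _ _ Es Es0; have := osc _ _ Es0 Es.
  by rewrite -/r (ger0_norm (_ : 0 <= s - _)) ?subr_ge0// ler_norml; lra.
apply: (@lebesgue_within_distance_le _ (sigma - r)) => // s [Es] /=.
rewrite in_itv/= => s_sigma; have := osc _ _ Es Es0; have := osc _ _ Es0 Es.
by rewrite -/r (ler0_norm (_ : s - _ <= 0)) ?subr_le0// ler_norml; lra.
Qed.

Lemma product_lebesgue_shear (w : R) (S : set (mR * mR)) : measurable S ->
  (leb \x leb)%E S =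
  (\int[leb]_xi leb [set s : mR | S (((xi : R) - w * (s : R))%R, s)])%E.
Proof.
move=> mS; pose shear (z : mR * mR) : mR * mR := (z.1 - w * z.2, z.2).
have mshear : measurable_fun setT shear.
  by apply: measurable_fun_pair => //; apply: measurable_funB => //; exact: measurable_funM.
have mS' := measurable_preimage mshear mS.
transitivity ((leb \x leb)%E (shear @^-1` S)); last first.
  by apply: eq_integral => xi _ /=; rewrite xsectionE.
rewrite [LHS]product_measure_swap// [RHS]product_measure_swap//.
apply: eq_integral => s _ /=; rewrite !xsectionE.
rewrite -(lebesgue_measure_translation (w * s))//.
by have := measurable_ysection s mS; rewrite ysectionE.
Qed.

Lemma measurable_sqrt_dist (x0 : R) :
  measurable_fun setT (fun x : mR => Num.sqrt `|x - x0| : mR).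
Proof.
apply: (measurableT_comp measurable_sqrtr).
by apply: (measurableT_comp (@normr_measurable R setT)); exact: measurable_funB.
Qed.

Lemma integral_inve_sqrt_le (x0 a b : R) : a <= b ->
  (\int[leb]_(x in `[a, b]%classic) (Num.sqrt `|(x : R) - x0|)%:E^-1
     <= (b - a + 4)%:E)%E.
Proof.
move=> ab; have mab : measurable (`[a, b]%classic : set mR) by exact: measurable_itv.
apply: (le_trans (integral_inve_le_sqr (c := 2) mab (measurable_sqrt_dist x0) _ _ _)) => //.
  move=> v v0; apply: (lebesgue_within_distance_le (x := x0)); last 1 first.
  - by move=> s [_ /= sv]; rewrite -ler_sqrt ?sqr_ge0// sqrtr_sqr (gtr0_norm v0).
  - by apply: measurable_fun_le => //; apply: measurable_funTS; exact: measurable_sqrt_dist.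
  - exact: sqr_ge0.
rewrite /= lebesgue_measure_itv/= lte_fin -EFinB.
by case: ltP => _; rewrite -?EFinD lee_fin; lra.
Qed.

Definition unit_square : set (mR * mR) := `[0, 1]%classic `*` `[0, 1]%classic.

Lemma product_lebesgue_shear_le (S : set (mR * mR)) (w c xi0 : R) :
  measurable S -> S `<=` unit_square ->
  `|w| <= 1 -> 0 < c ->
  (forall xi : R, xi != xi0 ->
    (leb [set s : mR | S ((xi - w * s)%R, s)] <= (c / Num.sqrt `|xi - xi0|)%:E)%E) ->
  ((leb \x leb) S <= (7 * c)%:E)%E.
Proof.
move=> mS S01 w1 c0 Sc; rewrite (product_lebesgue_shear w)//.
pose I : set mR := `[(-1 : R), 2]%classic; have mI : measurable I by exact: measurable_itv.
rewrite (integral_support _ (D := I)); last first.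
  move=> xi /= xiN; rewrite (_ : [set _ | _] = set0) ?measure0//.
  apply/seteqP; split => // s /= /S01 [/=]; rewrite !in_itv/= => xs01 s01.
  apply: xiN; rewrite /I /= in_itv/=; move: xs01 s01 w1.
  by rewrite ler_norml => /andP[? ?] /andP[? ?] /andP[? ?]; apply/andP; split; nra.
apply: (@le_trans _ _ (\int[leb]_(xi in I)
    (c%:E * (Num.sqrt `|(xi : R) - xi0|)%:E^-1))%E).
  apply: nonneg_le_integral => // xi _.
  have [->|xi_neq] := eqVneq (xi : R) xi0.
    by rewrite subrr normr0 sqrtr0 inve0 gt0_muley ?lte_fin// leey.
  rewrite inver gt_eqF ?sqrtr_gt0 ?normr_gt0 ?subr_eq0// -EFinM; exact: Sc.
rewrite ge0_integralZl//; last 3 first.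
  apply: measurable_funTS; apply: (measurableT_comp measurable_inve).
  exact: measurable_sqrt_dist.
  by move=> xi _; rewrite inve_ge0 lee_fin sqrtr_ge0.
  by rewrite lee_fin ltW.
rewrite [7 * c]mulrC EFinM lee_wpmul2l ?lee_fin ?(ltW c0)//.
by apply: le_trans (integral_inve_sqrt_le _ _) _ => //; rewrite ?lee_fin; lra.
Qed.

End plane_lebesgue.

(** * Level sets of a difference of two distances *)

Section sqrt_difference.
Context {R : realType}.
Local Notation leb := (@lebesgue_measure R).

(* Rationalise: p - q = (p ^+ 2 - q ^+ 2) / (p + q), where the numerator is the
   same for both pairs. *)
Lemma difference_gap (p q p' q' S : R) :
  0 <= p <= S -> 0 <= q <= S -> 0 <= p' <= S -> 0 <= q' <= S ->
  p' ^+ 2 - q' ^+ 2 = p ^+ 2 - q ^+ 2 -> p <= p' ->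
  `|p ^+ 2 - q ^+ 2| * (p' ^+ 2 - p ^+ 2) <=
  4 * S ^+ 3 * `|(p - q) - (p' - q')|.
Proof.
move=> /andP[p0 pS] /andP[q0 qS] /andP[p'0 p'S] /andP[q'0 q'S] eqD pp'.
have S0 : 0 <= S by exact: le_trans pS.
have qq' : q <= q'.
  have : p ^+ 2 <= p' ^+ 2 by rewrite ler_pXn2r.
  by move=> pp'2; rewrite -(@ler_pXn2r _ 2)//; lra.
set D := p ^+ 2 - q ^+ 2; set delta := (p - q) - (p' - q').
pose X := (p' - p) + (q' - q).
have X0 : 0 <= X by rewrite addr_ge0// subr_ge0.
have increment_le : p' ^+ 2 - p ^+ 2 <= S * X.
  have : p' ^+ 2 - p ^+ 2 <= 2 * S * (p' - p) by rewrite subr_sqr; nra.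
  have : q' ^+ 2 - q ^+ 2 <= 2 * S * (q' - q) by rewrite subr_sqr; nra.
  by rewrite /X; lra.
have rationalised : `|delta| * ((p + q) * (p' + q')) = `|D| * X.
  rewrite -[in RHS](ger0_norm X0) -[X in _ * X = _]ger0_norm ?mulr_ge0 ?addr_ge0//.
  rewrite -!normrM; congr `|_|.
  have -> : delta * ((p + q) * (p' + q')) =
    (p ^+ 2 - q ^+ 2) * (p' + q') - (p' ^+ 2 - q' ^+ 2) * (p + q).
    by rewrite /delta; ring.
  by rewrite eqD /D /X; ring.
have sums_le : (p + q) * (p' + q') <= (2 * S) * (2 * S).
  by apply: ler_pM; rewrite ?addr_ge0//; lra.
apply: (@le_trans _ _ (S * (`|D| * X))).
  by rewrite mulrCA ler_wpM2l.
rewrite -rationalised (_ : 4 * S ^+ 3 * _ = S * (`|delta| * ((2 * S) * (2 * S)))).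
  by rewrite !ler_wpM2l.
by ring.
Qed.

Section quadratics_with_common_centre.
Variables alpha beta q S : R.
Hypotheses (alpha0 : 0 <= alpha) (beta0 : 0 <= beta) (q0 : 0 < q) (S0 : 0 <= S).
Let diff (u : R) : R := Num.sqrt (alpha + q * u ^+ 2) - Num.sqrt (beta + q * u ^+ 2).

Lemma radius_gap (m u u' : R) : 0 <= m -> m <= u -> u <= u' ->
  alpha + q * u' ^+ 2 <= S ^+ 2 -> beta + q * u' ^+ 2 <= S ^+ 2 ->
  `|alpha - beta| * q * m * (u' - u) <= 2 * S ^+ 3 * `|diff u - diff u'|.
Proof.
move=> m0 mu uu' alphaS betaS; have u0 := le_trans m0 mu.
have quu' : q * u ^+ 2 <= q * u' ^+ 2.
  by rewrite ler_wpM2l ?(ltW q0)// ler_pXn2r ?nnegrE// (le_trans u0).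
have quadratic_ge0 a v : 0 <= a -> 0 <= a + q * v ^+ 2.
  by move=> a0; rewrite addr_ge0// mulr_ge0 ?sqr_ge0// ltW.
have sqrt_range a v : 0 <= a -> a + q * u' ^+ 2 <= S ^+ 2 ->
    q * v ^+ 2 <= q * u' ^+ 2 -> 0 <= Num.sqrt (a + q * v ^+ 2) <= S.
  move=> a0 aS vu'; rewrite sqrtr_ge0 -(ger0_norm S0) -sqrtr_sqr ler_wsqrtr//.
  by rewrite (le_trans _ aS)// lerD2l.
have := difference_gap (sqrt_range _ u alpha0 alphaS quu') (sqrt_range _ u beta0 betaS quu')
  (sqrt_range _ u' alpha0 alphaS (lexx _)) (sqrt_range _ u' beta0 betaS (lexx _)).
rewrite !sqr_sqrtr ?quadratic_ge0// -!/(diff _) => gap.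
have {}gap : `|alpha - beta| * (q * ((u' - u) * (u' + u))) <=
    4 * S ^+ 3 * `|diff u - diff u'|.
  rewrite (_ : alpha - beta = alpha + q * u ^+ 2 - (beta + q * u ^+ 2)); last by ring.
  rewrite (_ : q * (_ * _) = alpha + q * u' ^+ 2 - (alpha + q * u ^+ 2)); last by ring.
  by apply: gap; [ring|rewrite ler_wsqrtr// lerD2l].
have : `|alpha - beta| * (q * ((u' - u) * (2 * m))) <=
    `|alpha - beta| * (q * ((u' - u) * (u' + u))).
  by rewrite !ler_wpM2l ?subr_ge0 ?(ltW q0)//; lra.
by move: gap; lra.
Qed.

Lemma lebesgue_sqrt_difference_level_le (sigma y eps m : R)
    (E : set (measurableTypeR R)) :
  measurable E -> alpha != beta -> 0 <= eps -> 0 < m ->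
  (forall s, E s -> [/\ alpha + q * (s - sigma) ^+ 2 <= S ^+ 2,
     beta + q * (s - sigma) ^+ 2 <= S ^+ 2,
     y <= diff (s - sigma) <= y + eps & m <= `|s - sigma|]) ->
  (leb E <= (8 * S ^+ 3 * eps / (`|alpha - beta| * q * m))%:E)%E.
Proof.
move=> mE ab eps0 m0 Elevel.
have den0 : 0 < `|alpha - beta| * q * m by rewrite !mulr_gt0// normr_gt0 subr_eq0.
pose delta := 2 * S ^+ 3 * eps / (`|alpha - beta| * q * m).
have delta0 : 0 <= delta by rewrite divr_ge0 ?mulr_ge0 ?exprn_ge0// ltW.
rewrite (_ : 8 * _ * _ / _ = 4 * delta); last by rewrite /delta; ring.
have diff_norm u : diff `|u| = diff u by rewrite /diff real_normK ?num_real.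
apply: (lebesgue_distance_oscillation_le (sigma := sigma)) => // s s' Es Es'.
have [us|/ltW su] := leP `|s' - sigma| `|s - sigma|; first by apply: le_trans delta0; lra.
have [_ _ sy ms] := Elevel _ Es; have [alphaS betaS s'y _] := Elevel _ Es'.
rewrite /delta ler_pdivlMr// mulrC.
apply: le_trans (radius_gap (ltW m0) ms su _ _) _; rewrite ?real_normK ?num_real//.
rewrite !diff_norm ler_wpM2l ?mulr_ge0 ?exprn_ge0// ler_norml.
by move: sy s'y => /andP[? ?] /andP[? ?]; apply/andP; split; lra.
Qed.

End quadratics_with_common_centre.
End sqrt_difference.

Section plane_slope_weight.
Context {R : realType}.
Local Notation mR := (measurableTypeR R).
Local Notation leb := (@lebesgue_measure R).
Implicit Types (a b z : R * R).

(* Squared distance from z to a point that projects to a and whose squared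
   distance to the plane is h. *)
Definition lifted_sqdist (h : R) a z : R := h + (z.1 - a.1) ^+ 2 + (z.2 - a.2) ^+ 2.

Definition cross a b z : R :=
  (a.1 - b.1) * (z.2 - a.2) - (a.2 - b.2) * (z.1 - a.1).

Definition plane_gap a b : R := Num.max `|a.1 - b.1| `|a.2 - b.2|.

(* The derivative of |x - a| - |x - b| along the direction orthogonal to a - b
   vanishes where x is collinear with a and b and where x is equidistant from
   them; [slope_weight] measures the distance to both degeneracies.  The exponents
   1/2 and 1 are those for which the sublevel sets, and the level sets restricted
   to a superlevel set, both have linearly bounded measure. *)
Definition slope_weight (h k : R) a b z : R :=
  Num.sqrt (`|lifted_sqdist h a z - lifted_sqdist k b z| / (2 * plane_gap a b))
    * (`|cross a b z| / plane_gap a b).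

Definition coord_swap z : R * R := (z.2, z.1).

Lemma lifted_sqdist_swap h a z :
  lifted_sqdist h (coord_swap a) (coord_swap z) = lifted_sqdist h a z.
Proof. by rewrite /lifted_sqdist /=; ring. Qed.

Lemma plane_gap_swap a b : plane_gap (coord_swap a) (coord_swap b) = plane_gap a b.
Proof. exact: maxC. Qed.

Lemma slope_weight_swap h k a b z :
  slope_weight h k (coord_swap a) (coord_swap b) (coord_swap z) = slope_weight h k a b z.
Proof.
rewrite /slope_weight !lifted_sqdist_swap plane_gap_swap; congr (_ * (_ / _)).
by rewrite -normrN /cross /=; congr `|_|; ring.
Qed.

Section orthogonal_lines.
Variables (h k : R) (a b : R * R).
Hypotheses (ab1 : a.1 != b.1) (ab2 : `|a.2 - b.2| <= `|a.1 - b.1|).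

Let w := (a.2 - b.2) / (a.1 - b.1).
Let q := 1 + w ^+ 2.
Let line (xi s : R) : R * R := (xi - w * s, s).
(* [line xi0] consists of the points equidistant from the two centres, and
   [line xi (foot xi)] is collinear with a and b. *)
Let xi0 := (a.1 + b.1 + w * (a.2 + b.2)) / 2 + (h - k) / (2 * (a.1 - b.1)).
Let foot (xi : R) := (a.2 + w * (xi - a.1)) / q.

Let q_ge1 : 1 <= q. Proof. by rewrite /q lerDl sqr_ge0. Qed.
Let q_gt0 : 0 < q. Proof. exact: lt_le_trans q_ge1. Qed.
Let q_neq0 : q != 0. Proof. by rewrite gt_eqF. Qed.
Let ab1_neq0 : a.1 - b.1 != 0. Proof. by rewrite subr_eq0. Qed.
Let gapE : plane_gap a b = `|a.1 - b.1|. Proof. exact/max_idPl. Qed.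
Let gap_gt0 : 0 < plane_gap a b. Proof. by rewrite gapE normr_gt0. Qed.
Let b2E : b.2 = a.2 - w * (a.1 - b.1).
Proof. by rewrite /w mulfVK//; ring. Qed.

Let lifted_sqdistB xi s :
  lifted_sqdist h a (line xi s) - lifted_sqdist k b (line xi s)
  = - (2 * (a.1 - b.1) * (xi - xi0)).
Proof.
by rewrite /lifted_sqdist /xi0 /= b2E; move: w => w'; field; exact: ab1_neq0.
Qed.

Let crossE xi s : cross a b (line xi s) = (a.1 - b.1) * (q * (s - foot xi)).
Proof.
rewrite /foot mulrBr mulrCA divff// mulr1 /cross /q /= b2E.
by ring.
Qed.

Let lifted_sqdistE l (c : R * R) xi s : c.2 + w * (xi - c.1) = q * foot xi ->
  lifted_sqdist l c (line xi s) =
  lifted_sqdist l c (line xi (foot xi)) + q * (s - foot xi) ^+ 2.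
Proof.
move=> cfoot; have -> : c = (c.1, q * foot xi - w * (xi - c.1)).
  by rewrite -cfoot addrK -surjective_pairing.
by rewrite /lifted_sqdist /q /=; ring.
Qed.

Let slope_weightE xi s :
  slope_weight h k a b (line xi s) = Num.sqrt `|xi - xi0| * (q * `|s - foot xi|).
Proof.
rewrite /slope_weight lifted_sqdistB crossE gapE normrN !normrM ger0_norm//.
rewrite (ger0_norm (ltW q_gt0)); by congr (Num.sqrt _ * _); field; rewrite normr_eq0.
Qed.

Lemma lebesgue_line_weight_sublevel_le (v xi : R) (E : set mR) : measurable E ->
  0 <= v -> xi != xi0 -> (forall s, E s -> slope_weight h k a b (line xi s) <= v) ->
  (leb E <= (2 * v / Num.sqrt `|xi - xi0|)%:E)%E.
Proof.
move=> mE v0 xi_neq Ev.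
have sqrt_gt0 : 0 < Num.sqrt `|xi - xi0| by rewrite sqrtr_gt0 normr_gt0 subr_eq0.
rewrite -mulrA; apply: (lebesgue_within_distance_le (x := foot xi)) => //.
  by rewrite divr_ge0// ltW.
move=> s /Ev; rewrite slope_weightE mulrC ler_pdivlMr//; apply: le_trans.
by rewrite ler_pM2r// ler_peMl.
Qed.

Lemma lebesgue_line_weight_level_le (S y eps m xi : R) (E : set mR) :
  measurable E -> 0 <= eps -> 0 < m -> 0 <= S -> 0 <= h -> 0 <= k -> xi != xi0 ->
  (forall s, E s -> let z := line xi s in
     [/\ lifted_sqdist h a z <= S ^+ 2, lifted_sqdist k b z <= S ^+ 2,
       y <= Num.sqrt (lifted_sqdist h a z) - Num.sqrt (lifted_sqdist k b z) <= y + eps &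
       m <= slope_weight h k a b z]) ->
  (leb E <= (4 * S ^+ 3 * eps / (plane_gap a b * m) / Num.sqrt `|xi - xi0|)%:E)%E.
Proof.
move=> mE eps0 m0 S0 h0 k0 xi_neq Elevel; set t := Num.sqrt _.
have t_gt0 : 0 < t by rewrite sqrtr_gt0 normr_gt0 subr_eq0.
have t2 : `|xi - xi0| = t ^+ 2 by rewrite sqr_sqrtr.
have lifted_sqdist0 l c z : 0 <= l -> 0 <= lifted_sqdist l c z.
  by move=> l0; rewrite !addr_ge0 ?sqr_ge0.
have afoot : a.2 + w * (xi - a.1) = q * foot xi by rewrite /foot [RHS]mulrC mulfVK.
have bfoot : b.2 + w * (xi - b.1) = q * foot xi by rewrite -afoot b2E; ring.
pose alpha := lifted_sqdist h a (line xi (foot xi)).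
pose beta := lifted_sqdist k b (line xi (foot xi)).
have gap_ab : `|alpha - beta| = 2 * plane_gap a b * t ^+ 2.
  by rewrite lifted_sqdistB gapE normrN !normrM ger0_norm// t2.
have level := @lebesgue_sqrt_difference_level_le _ alpha beta q S _ _ q_gt0 S0
  (foot xi) y eps (m / (q * t)) E mE _ eps0.
apply: le_trans (level _ _ _ _ _) _.
- exact: lifted_sqdist0.
- exact: lifted_sqdist0.
- by rewrite -subr_eq0 -normr_gt0 gap_ab !mulr_gt0// exprn_gt0.
- by rewrite divr_gt0// mulr_gt0.
- move=> s /Elevel/=; rewrite (lifted_sqdistE _ _ afoot) (lifted_sqdistE _ _ bfoot).
  rewrite slope_weightE => -[? ? ? ms]; split => //.
  by rewrite ler_pdivrMr ?mulr_gt0// mulrC -mulrA mulrCA.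
rewrite lee_fin gap_ab le_eqVlt; apply/orP; left; apply/eqP.
by field; rewrite !gt_eqF.
Qed.

End orthogonal_lines.

Let measurable_coord_swap : measurable_fun setT (coord_swap : mR * mR -> mR * mR).
Proof. exact: measurable_fun_pair. Qed.

Let neq_fst a b : 0 < plane_gap a b -> `|a.2 - b.2| <= `|a.1 - b.1| -> a.1 != b.1.
Proof. by move=> + /max_idPl ab; rewrite /plane_gap ab normr_gt0 subr_eq0. Qed.

Let slope_le1 a b : a.1 != b.1 -> `|a.2 - b.2| <= `|a.1 - b.1| ->
  `|(a.2 - b.2) / (a.1 - b.1)| <= 1.
Proof.
by move=> ab1 ab; rewrite normrM normfV ler_pdivrMr ?normr_gt0 ?subr_eq0// mul1r.
Qed.

Let measurable_line (w xi : R) (S : set (mR * mR)) : measurable S ->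
  measurable [set s : mR | S (xi - w * s, s)].
Proof.
apply: measurable_preimage; apply: measurable_fun_pair => //.
by apply: measurable_funB => //; exact: measurable_funM.
Qed.

Lemma plane_weight_sublevel_le h k a b (v : R) (S : set (mR * mR)) :
  measurable S -> S `<=` unit_square -> 0 < plane_gap a b -> 0 < v ->
  (forall z, S z -> slope_weight h k a b z <= v) ->
  ((leb \x leb) S <= (14 * v)%:E)%E.
Proof.
wlog ab : a b S / `|a.2 - b.2| <= `|a.1 - b.1| => [wl|] mS S01 gab v0 Sv.
  have [ab|/ltW ba] := leP `|a.2 - b.2| `|a.1 - b.1|; first exact: (wl a b).
  rewrite product_measure_swap//; apply: (wl (coord_swap a) (coord_swap b)) => //.
  - exact: measurable_preimage measurable_coord_swap mS.
  - by move=> z /= /S01[].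
  - by rewrite plane_gap_swap.
  - by move=> z /Sv; rewrite -slope_weight_swap /coord_swap -surjective_pairing.
have ab1 := neq_fst gab ab.
rewrite (_ : 14 * v = 7 * (2 * v)); last by ring.
apply: (product_lebesgue_shear_le mS S01 (slope_le1 ab1 ab)) => [|xi xi_neq].
  by rewrite mulr_gt0.
apply: (lebesgue_line_weight_sublevel_le (h := h) (k := k) ab1 ab
  (measurable_line _ _ mS) (ltW v0) xi_neq).
by move=> s /Sv.
Qed.

Lemma plane_weight_level_le h k a b (L y eps m : R) (S : set (mR * mR)) :
  measurable S -> S `<=` unit_square -> 0 < plane_gap a b ->
  0 < eps -> 0 < m -> 0 < L -> 0 <= h -> 0 <= k ->
  (forall z, S z -> [/\ lifted_sqdist h a z <= L ^+ 2, lifted_sqdist k b z <= L ^+ 2,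
     y <= Num.sqrt (lifted_sqdist h a z) - Num.sqrt (lifted_sqdist k b z) <= y + eps &
     m <= slope_weight h k a b z]) ->
  ((leb \x leb) S <= (28 * L ^+ 3 * eps / (plane_gap a b * m))%:E)%E.
Proof.
wlog ab : a b S / `|a.2 - b.2| <= `|a.1 - b.1|.
  move=> wl mS S01 gab eps0 m0 L0 h0 k0 Slevel.
  have [ab|/ltW ba] := leP `|a.2 - b.2| `|a.1 - b.1|; first exact: (wl a b).
  rewrite product_measure_swap// -plane_gap_swap.
  apply: (wl (coord_swap a) (coord_swap b)) => //.
  - exact: measurable_preimage measurable_coord_swap mS.
  - by move=> z /= /S01[].
  - by rewrite plane_gap_swap.
  - move=> z /Slevel; rewrite -slope_weight_swap -(lifted_sqdist_swap h a).
    by rewrite -(lifted_sqdist_swap k b) /coord_swap -surjective_pairing.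
move=> mS S01 gab eps0 m0 L0 h0 k0 Slevel; have ab1 := neq_fst gab ab.
rewrite (_ : 28 * _ * _ / _ = 7 * (4 * L ^+ 3 * eps / (plane_gap a b * m))); last by ring.
apply: (product_lebesgue_shear_le mS S01 (slope_le1 ab1 ab)) => [|xi xi_neq].
  by rewrite !(mulr_gt0, invr_gt0)// exprn_gt0.
apply: (lebesgue_line_weight_level_le (y := y) ab1 ab (measurable_line _ _ mS)
  (ltW eps0) m0 (ltW L0) h0 k0 xi_neq).
by move=> s /Slevel.
Qed.

End plane_slope_weight.

(** * From the plane to the cube *)

Section tuple_plane_slices.
Context {R : realType}.
Local Notation mR := (measurableTypeR R).
Local Notation leb := (@lebesgue_measure R).

(* The plane is spanned by the first two coordinates. *)
Definition plane_cons d (z : mR * mR) (t : Rpoint R d) : Rpoint R d.+2 :=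
  pcons (z.1, pcons (z.2, t)).

Lemma measurable_plane_cons d (disp : measure_display) (T : measurableType disp)
    (f : T -> mR * mR) (g : T -> Rpoint R d) :
  measurable_fun setT f -> measurable_fun setT g ->
  measurable_fun setT (fun x => plane_cons (f x) (g x)).
Proof.
by move=> mf mg; do 2?apply: measurable_cons => //; exact: measurableT_comp mf.
Qed.

Lemma measurable_plane_slice d (t : Rpoint R d) (A : set (Rpoint R d.+2)) :
  measurable A -> measurable [set z : mR * mR | A (plane_cons z t)].
Proof.
move=> mA; apply: (measurable_preimage _ mA).
exact: measurable_plane_cons.
Qed.

Lemma lebesgue_tuple_plane d (A : set (Rpoint R d.+2)) : measurable A ->
  (lebesgue_tuple d.+2 A =
   \int[lebesgue_tuple d]_t (leb \x leb) [set z | A (plane_cons z t)])%E.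
Proof.
move=> mA.
pose B : set ((mR * Rpoint R d) * mR) := [set u | A (plane_cons (u.1.1, u.2) u.1.2)].
have mB : measurable B.
  apply: (measurable_preimage _ mA); apply: measurable_plane_cons.
    by apply: measurable_fun_pair => //; exact: measurableT_comp.
  exact: measurableT_comp.
transitivity (\int[leb]_x \int[lebesgue_tuple d]_t leb (xsection B (x, t)))%E.
  apply: eq_integral => x _ /=; rewrite xsectionE.
  have mAx : measurable [set yt : mR * Rpoint R d | A (pcons (x, pcons yt))].
    apply: (measurable_preimage _ mA); apply: measurable_cons => //.
    exact: measurable_pcons.
  rewrite -[LHS]/((leb \x lebesgue_tuple d)%E _) product_measure_swap//.
rewrite (fubini_tonelli (fun xt => leb (xsection B xt)))//.
exact: (measurable_fun_xsection leb mB).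
Qed.

Lemma unit_cube_pcons d (z : mR * Rpoint R d) :
  unit_cube (pcons z) <-> 0 <= (z.1 : R) <= 1 /\ unit_cube z.2.
Proof.
split=> [cz|[z1 z2] j].
  by split=> [|j]; [exact: (cz ord0)|have := cz (lift ord0 j); rewrite tnthS].
by case: (unliftP ord0 j) => [i|] ->; [rewrite tnthS; exact: z2|].
Qed.

Lemma unit_cube_plane_cons d (z : mR * mR) (t : Rpoint R d) :
  unit_cube (plane_cons z t) -> unit_square z /\ unit_cube t.
Proof.
by move=> /unit_cube_pcons[z1 /unit_cube_pcons[z2 ct]]; do 2?split; rewrite //= in_itv.
Qed.

Lemma measurable_unit_cube d : measurable (@unit_cube R d).
Proof.
rewrite (_ : unit_cube = \bigcap_(j in [set: 'I_d]) ((@tnth _ _)^~ j @^-1` `[0, 1])).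
  apply: fin_bigcap_measurable => // j _; apply: measurable_preimage => //.
  exact: measurable_tnth.
by apply/seteqP; split => [p cp j _|p cp j]; have := cp j; rewrite /= in_itv//; apply.
Qed.

Lemma lebesgue_unit_cube d : lebesgue_tuple d (@unit_cube R d) = 1%E.
Proof.
elim: d => [|d IH]; first by rewrite /= diracE mem_set// => -[].
rewrite -[LHS]/((leb \x lebesgue_tuple d)%E (@pcons R d @^-1` unit_cube)).
have -> : @pcons R d @^-1` unit_cube = `[0, 1]%classic `*` unit_cube.
  apply/seteqP; split => z; first by move=> /unit_cube_pcons[]; rewrite /= in_itv.
  by move=> [/=]; rewrite in_itv => ? ?; exact/unit_cube_pcons.
rewrite product_measure1E//; last exact: measurable_unit_cube.
by rewrite IH mule1 /= lebesgue_measure_itv/= lte_fin ltr01 sube0.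
Qed.

Lemma lebesgue_tuple_le_plane_slice d (A : set (Rpoint R d.+2)) (K : R) :
  measurable A -> 0 <= K -> A `<=` unit_cube ->
  (forall t : Rpoint R d,
     ((leb \x leb) [set z | A (plane_cons z t)] <= K%:E)%E) ->
  (lebesgue_tuple d.+2 A <= K%:E)%E.
Proof.
move=> mA K0 Acube AK; rewrite lebesgue_tuple_plane//.
rewrite (integral_support _ (D := unit_cube)).
  rewrite -[leRHS]mule1 -(lebesgue_unit_cube d); apply: nonneg_integral_le_cst.
    exact: measurable_unit_cube.
  by move=> t _; rewrite measure_ge0 AK.
move=> t nt; rewrite (_ : [set z | _] = set0) ?measure0//.
by apply/seteqP; split => // z /Acube/unit_cube_plane_cons[].
Qed.

End tuple_plane_slices.

Section squared_distance.
Context {R : realType}.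
Local Notation mR := (measurableTypeR R).

Definition sqdist d (p q : Rpoint R d) : R :=
  \sum_(j < d) ((tnth p j : R) - tnth q j) ^+ 2.

Lemma sqdist_ge0 d (p q : Rpoint R d) : 0 <= sqdist p q.
Proof. by rewrite sumr_ge0// => j _; exact: sqr_ge0. Qed.

Lemma sqdist_unit_cube_le d (p q : Rpoint R d) :
  unit_cube p -> unit_cube q -> sqdist p q <= d%:R.
Proof.
move=> cp cq; rewrite -[leRHS]mulr1 -[d in leRHS]card_ord mulr_natl -sumr_const.
apply: ler_sum => j _.
by have /andP[? ?] := cp j; have /andP[? ?] := cq j; nra.
Qed.

Lemma measurable_sqdist d (disp : measure_display) (T : measurableType disp)
    (f g : T -> Rpoint R d) : measurable_fun setT f -> measurable_fun setT g ->
  measurable_fun setT (fun x => sqdist (f x) (g x) : mR).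
Proof.
move=> mf mg; apply: measurable_sum => j; apply: measurable_funX.
by apply: measurable_funB; exact: (measurableT_comp (measurable_tnth j)).
Qed.

Definition distance_difference d (a b x : Rpoint R d) : R := dist2 x a - dist2 x b.

Lemma measurable_dist2 d (disp : measure_display) (T : measurableType disp)
    (f g : T -> Rpoint R d) : measurable_fun setT f -> measurable_fun setT g ->
  measurable_fun setT (fun x => dist2 (f x) (g x) : mR).
Proof.
move=> mf mg; apply: (measurableT_comp measurable_sqrtr); exact: measurable_sqdist.
Qed.

End squared_distance.

Section distance_difference.
Context {R : realType} {d : nat}.
Local Notation mR := (measurableTypeR R).
Local Notation leb := (@lebesgue_measure R).
Local Notation point := (Rpoint R d.+2).
Local Notation lam := (@lebesgue_tuple R d.+2).
Implicit Types (a b x : point).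

Definition plane_part x : R * R := (tnth x ord0, tnth x (lift ord0 ord0)).

Definition tail_part x : Rpoint R d := [tuple tnth x (lift ord0 (lift ord0 j)) | j < d].

Definition gap a b : R := plane_gap (plane_part a) (plane_part b).

Definition weight a b x : R :=
  slope_weight (sqdist (tail_part x) (tail_part a)) (sqdist (tail_part x) (tail_part b))
    (plane_part a) (plane_part b) (plane_part x).

Lemma sqdist_plane_tail x a :
  sqdist x a = lifted_sqdist (sqdist (tail_part x) (tail_part a)) (plane_part a) (plane_part x).
Proof.
rewrite /sqdist !big_ord_recl /lifted_sqdist /= addrA addrC addrA; congr (_ + _ + _).
by apply: eq_bigr => j _; rewrite !tnth_mktuple.
Qed.

Lemma plane_part_cons z (t : Rpoint R d) : plane_part (plane_cons z t) = z.
Proof. by rewrite [RHS]surjective_pairing /plane_part /plane_cons /pcons tnthS !tnth0. Qed.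

Lemma tail_part_cons z (t : Rpoint R d) : tail_part (plane_cons z t) = t.
Proof. by apply: eq_from_tnth => j; rewrite tnth_mktuple !tnthS. Qed.

Lemma measurable_plane_part : measurable_fun setT (plane_part : point -> mR * mR).
Proof. by apply: measurable_fun_pair; exact: measurable_tnth. Qed.

Let measurable_plane1 : measurable_fun setT (fun x : point => (plane_part x).1 : mR).
Proof. exact: (measurableT_comp measurable_fst measurable_plane_part). Qed.

Let measurable_plane2 : measurable_fun setT (fun x : point => (plane_part x).2 : mR).
Proof. exact: (measurableT_comp measurable_snd measurable_plane_part). Qed.

Lemma measurable_gap b : measurable_fun setT (fun a => gap a b : mR).
Proof.
by apply: measurable_maxr; apply: (measurableT_comp (@normr_measurable R setT));
  exact: measurable_funB.
Qed.

Lemma measurable_weight a b : measurable_fun setT (weight a b : point -> mR).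
Proof.
rewrite /weight /slope_weight; under eq_fun do rewrite -!sqdist_plane_tail.
have mnorm (f : point -> mR) : measurable_fun setT f ->
    measurable_fun setT (fun x => `|f x : R| : mR).
  exact: (measurableT_comp (@normr_measurable R setT)).
apply: measurable_funM.
  apply: (measurableT_comp measurable_sqrtr); apply: measurable_funM => //.
  by apply: mnorm; apply: measurable_funB; exact: measurable_sqdist.
apply: measurable_funM => //; apply: mnorm; rewrite /cross.
by apply: measurable_funB; apply: measurable_funM => //; exact: measurable_funB.
Qed.

Lemma gap_unit_cube_le1 a b : unit_cube a -> unit_cube b -> gap a b <= 1.
Proof.
move=> ca cb; rewrite ge_max !ler_norml; apply/andP; split; apply/andP; split;
by rewrite /=; move: (ca ord0) (cb ord0) (ca (lift ord0 ord0)) (cb (lift ord0 ord0))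
  => /andP[? ?] /andP[? ?] /andP[? ?] /andP[? ?]; lra.
Qed.

Lemma lebesgue_weight_sublevel_le a b (v : R) : 0 < gap a b -> 0 < v ->
  (lam (unit_cube `&` [set x | weight a b x <= v]%R) <= (14 * v)%:E)%E.
Proof.
move=> gab v0; set A := _ `&` _.
have mA : measurable A.
  apply: measurable_fun_le => //; [exact: measurable_unit_cube|].
  exact: measurable_funTS (measurable_weight a b).
apply: lebesgue_tuple_le_plane_slice => // [|x []//|t]; first by rewrite mulr_ge0// ltW.
apply: (plane_weight_sublevel_le (h := sqdist t (tail_part a))
  (k := sqdist t (tail_part b)) _ _ gab v0); first exact: measurable_plane_slice.
- by move=> z [/unit_cube_plane_cons[]].
- by move=> z [_]; rewrite /= /weight plane_part_cons tail_part_cons.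
Qed.

Lemma lebesgue_weight_level_le a b (y eps m : R) (A : set point) :
  unit_cube a -> unit_cube b -> 0 < gap a b -> 0 < eps -> 0 < m ->
  measurable A -> A `<=` unit_cube ->
  (forall x, A x -> y <= distance_difference a b x <= y + eps /\ m <= weight a b x) ->
  (lam A <= (28 * Num.sqrt d.+2%:R ^+ 3 * eps / (gap a b * m))%:E)%E.
Proof.
move=> ca cb gab eps0 m0 mA Acube Alevel.
have L0 : 0 < Num.sqrt d.+2%:R :> R by rewrite sqrtr_gt0 ltr0n.
apply: lebesgue_tuple_le_plane_slice => // [|t].
  by rewrite divr_ge0 ?mulr_ge0 ?exprn_ge0// ltW.
apply: (plane_weight_level_le (h := sqdist t (tail_part a))
  (k := sqdist t (tail_part b)) (y := y) _ _ gab eps0 m0 L0);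
  rewrite ?sqdist_ge0//; first exact: measurable_plane_slice.
- by move=> z /Acube/unit_cube_plane_cons[].
- move=> z Az; have [Fx Wx] := Alevel _ Az; have cx := Acube _ Az.
  move: Fx Wx (sqdist_unit_cube_le cx ca) (sqdist_unit_cube_le cx cb).
  rewrite /distance_difference /dist2 -!/(sqdist _ _) /weight !sqdist_plane_tail.
  by rewrite plane_part_cons tail_part_cons sqr_sqrtr ?ler0n.
Qed.

Lemma lebesgue_gap_sublevel_le b (v : R) : 0 < v ->
  (lam (unit_cube `&` [set a | gap a b <= v]%R) <= (4 * v ^+ 2)%:E)%E.
Proof.
move=> v0; set A := _ `&` _; have mA : measurable A.
  apply: measurable_fun_le => //; [exact: measurable_unit_cube|].
  exact: measurable_funTS (measurable_gap b).
apply: lebesgue_tuple_le_plane_slice => // [|a []//|t]; first by rewrite mulr_ge0 ?sqr_ge0.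
pose I (c : R) : set mR := `[c - v, c + v]%classic.
have mI c : measurable (I c) by exact: measurable_itv.
have lebI c : (leb (I c) <= (2 * v)%:E)%E.
  apply: (lebesgue_within_distance_le (x := c)) (ltW v0) _ => //.
  by move=> s; rewrite /I /= in_itv/= ler_distl.
apply: (@le_trans _ _ ((leb \x leb) (I (plane_part b).1 `*` I (plane_part b).2))%E).
  apply: le_measure; rewrite ?inE; first exact: measurable_plane_slice.
    exact: measurableX.
  move=> z [_]; rewrite /= /gap plane_part_cons ge_max !ler_distl => /andP[z1 z2].
  by rewrite /I; split; rewrite /= in_itv.
rewrite [leLHS]product_measure1E// (_ : 4 * v ^+ 2 = (2 * v) * (2 * v)); last by ring.
by rewrite EFinM; apply: lee_pmul => //; exact: lebI.
Qed.

Lemma integral_inve_gap_le b : (\int[lam]_(a in unit_cube) (gap a b)%:E^-1 <= 9%:E)%E.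
Proof.
have gap0 a : 0 <= gap a b by rewrite le_max normr_ge0.
apply: le_trans (integral_inve_le_sqr (@measurable_unit_cube R d.+2)
  (measurable_gap b) gap0 _ (lebesgue_gap_sublevel_le b)) _ => //.
by rewrite [X in (X + _)%E]lebesgue_unit_cube -EFinD lee_fin; lra.
Qed.

End distance_difference.

(** * The gain of a 2-change *)

Section two_points.
Context {R : realType} {d : nat}.
Local Notation point := (Rpoint R d.+2).
Local Notation lam := (@lebesgue_tuple R d.+2).

Lemma product_distance_difference_le (a b : point) (eps : R) (J : nat)
    (E : set (point * point)) :
  unit_cube a -> unit_cube b -> 0 < gap a b -> 0 < eps -> 1 <= eps * J%:R ->
  measurable E ->
  (forall z, E z -> [/\ unit_cube z.1, unit_cube z.2 &
     0 <= distance_difference a b z.1 - distance_difference a b z.2 <= eps]) ->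
  ((lam \x lam) E <= (56 * Num.sqrt d.+2%:R ^+ 3 * eps
     * (1 + 14 * series harmonic J) / gap a b)%:E)%E.
Proof.
move=> ca cb gab eps0 epsJ mE Esub.
set S := Num.sqrt d.+2%:R; pose K := 28 * S ^+ 3 * eps / gap a b.
have S3_ge1 : 1 <= S ^+ 3 by rewrite exprn_ege1// -[leLHS]sqrtr1 ler_wsqrtr// ler1n.
have eps_le_K : eps <= K.
  rewrite ler_pdivlMr// mulrC ler_pM2r//.
  by apply: le_trans (gap_unit_cube_le1 ca cb) _; lra.
have K0 : 0 < K := lt_le_trans eps0 eps_le_K.
have KJ : 1 <= K * J%:R by apply: le_trans epsJ _; rewrite ler_wpM2r.
rewrite (_ : 56 * _ * _ * _ / _ = 2 * K * (1 + 14 * series harmonic J)); last first.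
  by rewrite /K; ring.
apply: (product_small_difference_le (@measurable_unit_cube R d.+2)
  (measurable_weight a b) _ K0 KJ _ _ mE Esub).
- by rewrite lebesgue_unit_cube.
- by move=> v; exact: lebesgue_weight_sublevel_le.
- move=> y m A mA Acube m0 /(lebesgue_weight_level_le ca cb gab eps0 m0 mA Acube).
  by rewrite invfM mulrA.
Qed.

End two_points.

Section density.
Context {R : realType} {d : nat} {disp : measure_display}
  {Omega : measurableType disp} (P : probability Omega R).
Variables (phi : R) (f : Rpoint R d -> R) (X : {RV P >-> Rpoint R d}).
Hypothesis Xf : has_density X f.

Lemma distribution_le_lebesgue : (forall p, unit_cube p -> 0 <= f p <= phi) ->
  0 <= phi -> forall A, measurable A ->
  (distribution P X A <= phi%:E * lebesgue_tuple d A)%E.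
Proof.
move=> fphi phi0 A mA; have mcube := @measurable_unit_cube R d; rewrite Xf//.
apply: (@le_trans _ _ (phi%:E * lebesgue_tuple d (A `&` unit_cube))%E).
  by apply: nonneg_integral_le_cst => [|p [_ /fphi]]; [exact: measurableI|rewrite !lee_fin].
by rewrite lee_wpmul2l ?lee_fin// le_measure ?inE//; exact: measurableI.
Qed.

Lemma ae_unit_cube : {ae P, forall w, unit_cube (X w)}.
Proof.
have moutside := measurableC (@measurable_unit_cube R d).
exists (X @^-1` ~` unit_cube); split => //; first exact: measurable_preimage.
by have := Xf moutside; rewrite setICl integral_set0.
Qed.

End density.

Section joint_law.
Context {R : realType} {n d : nat} {disp : measure_display}
  {Omega : measurableType disp} (P : probability Omega R).
Variable X : 'I_n -> {RV P >-> Rpoint R d}.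
Hypothesis indX : mutually_independent X.
Implicit Types (s t : seq 'I_n) (A : 'I_n -> set (Rpoint R d)).

Lemma mutually_independent_seq s A : uniq s -> (forall i, measurable (A i)) ->
  (P (\big[setI/setT]_(i <- s) (X i @^-1` A i)) =
   \prod_(i <- s) distribution P (X i) (A i))%E.
Proof.
move=> uniq_s mA; rewrite -bigcap_seq big_uniq//.
transitivity (\prod_(i in [set i in s]%SET) distribution P (X i) (A i))%E.
  rewrite -(indX _ mA); congr (P _).
  by apply: eq_bigcapl; split => i; rewrite /= inE.
by apply: eq_bigl => i; rewrite inE.
Qed.

(* Z has law m and is independent of the points whose index is not in t. *)
Definition independent_law t (dT : measure_display) (T : measurableType dT)
    (Z : Omega -> T) (m : set T -> \bar R) : Prop :=
  forall s A, uniq (t ++ s) -> (forall i, measurable (A i)) ->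
    law_given P (\big[setI/setT]_(i <- s) (X i @^-1` A i)) Z m.

Let measurable_events s A : (forall i, measurable (A i)) ->
  measurable (\big[setI/setT]_(i <- s) (X i @^-1` A i)).
Proof. by move=> mA; apply: bigsetI_measurable => i _; exact: measurable_funPTI. Qed.

Let events_cons (s : seq 'I_n) A (i : 'I_n) (B : set (Rpoint R d)) : i \notin s ->
  X i @^-1` B `&` \big[setI/setT]_(j <- s) (X j @^-1` A j) =
  \big[setI/setT]_(j <- i :: s) (X j @^-1` (if j == i then B else A j)).
Proof.
move=> i_notin_s; rewrite big_cons eqxx; congr (_ `&` _); apply: eq_big_seq => j js.
by case: eqP => // ji; rewrite -ji js in i_notin_s.
Qed.

Lemma independent_law1 i : independent_law [:: i] (X i) (distribution P (X i)).
Proof.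
move=> s A /=/andP[i_notin_s uniq_s] mA E mE; rewrite events_cons//.
have mA' j : measurable (if j == i then E else A j) by case: ifP.
rewrite mutually_independent_seq//= ?i_notin_s// big_cons eqxx.
rewrite (mutually_independent_seq uniq_s mA); congr (_ * _)%E; apply: eq_big_seq => j js.
by case: eqP => // ji; rewrite -ji js in i_notin_s.
Qed.

Lemma independent_law_cons i t (dT : measure_display) (T : measurableType dT)
    (Z : Omega -> T) (m : probability T R) : measurable_fun setT Z ->
  independent_law t Z m ->
  independent_law (i :: t) (fun w => (X i w, Z w)) (distribution P (X i) \x m)%E.
Proof.
move=> mZ tZ s A /= /andP[]; rewrite mem_cat negb_or => /andP[i_notin_t i_notin_s] uniq_ts mA.
have uniq_s : uniq s by move: uniq_ts; rewrite cat_uniq => /and3P[].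
apply: law_given_pair => //; first exact: measurable_events.
  by apply: independent_law1 => //=; rewrite i_notin_s.
move=> B mB; rewrite events_cons//; apply: tZ => [|j]; last by case: ifP.
by rewrite -cat1s uniq_catCA /= mem_cat negb_or i_notin_t i_notin_s.
Qed.

Lemma joint_law4 i j k l : uniq [:: i; j; k; l] ->
  forall E : set (Rpoint R d * (Rpoint R d * (Rpoint R d * Rpoint R d))),
  measurable E ->
  P [set w | E (X i w, (X j w, (X k w, X l w)))] =
  (distribution P (X i) \x (distribution P (X j) \x
    (distribution P (X k) \x distribution P (X l))))%E E.
Proof.
move=> uniq_ijkl E mE.
have mX u : measurable_fun setT (X u) by exact: measurable_funP.
have mkl : measurable_fun setT (fun w => (X k w, X l w)) by exact: measurable_fun_pair.
have mjkl : measurable_fun setT (fun w => (X j w, (X k w, X l w))).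
  exact: measurable_fun_pair.
have law2 := @independent_law_cons k _ _ _ _ _ (mX l) (@independent_law1 l).
have law3 := @independent_law_cons j _ _ _ _ _ mkl law2.
have := @independent_law_cons i _ _ _ _ _ mjkl law3 [::] (fun=> setT).
rewrite cats0 big_nil => /(_ uniq_ijkl (fun=> measurableT) E mE).
by rewrite setIT probability_setT mule1.
Qed.

End joint_law.

Local Notation quad T := (T * (T * (T * T)))%type.

Definition quad_map (T U : Type) (g : T -> U) (q : quad T) : quad U :=
  (g q.1, (g q.2.1, (g q.2.2.1, g q.2.2.2))).

Definition quad_uniq (T : eqType) (q : quad T) : bool :=
  uniq [:: q.1; q.2.1; q.2.2.1; q.2.2.2].

Lemma quad_uniq_card (T : finType) (q : quad T) : quad_uniq q -> (3 < #|T|)%N.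
Proof.
by move=> /card_uniqP card4; have := max_card (mem [:: q.1; q.2.1; q.2.2.1; q.2.2.2]);
  rewrite card4.
Qed.

Section four_points.
Context {R : realType} {d : nat}.
Local Notation point := (Rpoint R d).

(* For the 2-change that replaces the edges u1u2 and v1v2 by u1v1 and u2v2, the
   vertices are listed in the order v1, u2, u1, v2: the last two points are
   compared through the distances to the first two. *)
Definition two_change_gain (z : quad point) : R :=
  distance_difference z.2.1 z.1 z.2.2.1 - distance_difference z.2.1 z.1 z.2.2.2.

Definition small_gain (eps : R) : set (quad point) :=
  (unit_cube `*` (unit_cube `*` (unit_cube `*` unit_cube)))
  `&` (two_change_gain @^-1` `]0, eps]%classic).

Lemma measurable_small_gain eps : measurable (small_gain eps).
Proof.
have mcube := @measurable_unit_cube R d.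
have m2 : measurable_fun setT (fun z : quad point => z.2.1) by exact: measurableT_comp.
have m22 : measurable_fun setT (fun z : quad point => z.2.2) by exact: measurableT_comp.
have m3 : measurable_fun setT (fun z : quad point => z.2.2.1) by exact: measurableT_comp m22.
have m4 : measurable_fun setT (fun z : quad point => z.2.2.2) by exact: measurableT_comp m22.
apply: measurableI; first by do 3![apply: measurableX => //].
apply: (@measurable_preimage _ _ _ (measurableTypeR R)); last exact: measurable_itv.
by apply: measurable_funB; apply: measurable_funB; exact: measurable_dist2.
Qed.

End four_points.

Section small_gain_probability.
Context {R : realType} {n d : nat} {disp : measure_display}
  {Omega : measurableType disp} (P : probability Omega R).
Local Notation point := (Rpoint R d.+2).
Variables (phi : R) (f : 'I_n -> point -> R) (X : 'I_n -> {RV P >-> point}).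
Hypotheses (phi1 : 1 <= phi) (pX : perturbed_instance phi f X).
Variables (eps : R) (J : nat).
Hypotheses (eps0 : 0 < eps) (epsJ : 1 <= eps * J%:R).

Let C : R := 56 * Num.sqrt d.+2%:R ^+ 3 * eps * (1 + 14 * series harmonic J).

Let C_gt0 : 0 < C.
Proof.
rewrite !mulr_gt0 ?exprn_gt0 ?sqrtr_gt0 ?ltr0n//.
by rewrite ltr_pwDl// mulr_ge0// series_harmonic_ge0.
Qed.

Let phi0 : 0 <= phi. Proof. exact: le_trans phi1. Qed.

Let distribution_le i A : measurable A ->
  (distribution P (X i) A <= phi%:E * lebesgue_tuple d.+2 A)%E.
Proof. by case: pX => _ fphi Xf _; exact: (distribution_le_lebesgue (Xf i) (fphi i)). Qed.

Lemma pair_small_gain_le (a b : point) (k l : 'I_n) : unit_cube a -> unit_cube b ->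
  ((distribution P (X k) \x distribution P (X l))
     [set z | small_gain eps (b, (a, z))] <= (phi ^+ 2 * C)%:E * (gap a b)%:E^-1)%E.
Proof.
move=> ca cb; set E := [set z | _].
have mE : measurable E.
  apply: (measurable_preimage _ (measurable_small_gain eps)).
  by apply: measurable_fun_pair => //; exact: measurable_fun_pair.
have gap_ge0 : 0 <= gap a b by rewrite le_max normr_ge0.
have [gap0|gap_neq0] := eqVneq (gap a b) 0.
  rewrite gap0 inve0 gt0_muley ?leey// lte_fin mulr_gt0// exprn_gt0//.
  exact: lt_le_trans phi1.
have gab : 0 < gap a b by rewrite lt0r gap_neq0.
have Esub z : E z -> [/\ unit_cube z.1, unit_cube z.2 &
    0 <= distance_difference a b z.1 - distance_difference a b z.2 <= eps].
  by move=> [[_ [_ []]]] /= ? ?; rewrite in_itv/= => /andP[/ltW ? ?]; split => //; apply/andP.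
have := product_distance_difference_le ca cb gab eps0 epsJ mE Esub.
rewrite -/C inver (negbTE gap_neq0) -EFinM -[_ ^+ 2 * _ * _]mulrA EFinM => E_le.
apply: le_trans (product_measure_dominated_le phi0 phi0 (@distribution_le k)
  (@distribution_le l) mE) _.
by rewrite -expr2 lee_wpmul2l ?lee_fin ?sqr_ge0.
Qed.

Lemma triple_small_gain_le (b : point) (j k l : 'I_n) :
  ((distribution P (X j) \x (distribution P (X k) \x distribution P (X l)))
     (xsection (small_gain eps) b) <= (9 * phi ^+ 3 * C)%:E)%E.
Proof.
have mcube := @measurable_unit_cube R d.+2.
have mgap : measurable_fun setT (fun a : point => (gap a b)%:E^-1%E).
  by apply: (measurableT_comp measurable_inve); exact: measurable_gap.
have inve_gap_ge0 a : (0 <= (gap a b)%:E^-1)%E by rewrite inve_ge0 lee_fin le_max normr_ge0.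
have phiC0 : (0 <= (phi ^+ 2 * C)%:E)%E by rewrite lee_fin mulr_ge0 ?exprn_ge0// ltW.
rewrite -[leLHS]/(\int[distribution P (X j)]_a (distribution P (X k) \x distribution P (X l))
  (xsection (xsection (small_gain eps) b) a))%E (integral_support _ (D := unit_cube)); last first.
  move=> a na; rewrite /= (_ : xsection _ _ = set0) ?measure0//.
  by apply/seteqP; split => // z /xsectionP/xsectionP[[_ []]].
apply: (@le_trans _ _ (\int[distribution P (X j)]_(a in unit_cube)
    ((phi ^+ 2 * C)%:E * (gap a b)%:E^-1))%E).
  apply: nonneg_le_integral => // a ca.
  have [cb|ncb] := pselect (unit_cube b); last first.
    rewrite /= (_ : xsection _ _ = set0) ?measure0 ?mule_ge0//.
    by apply/seteqP; split => // z /xsectionP/xsectionP[[]].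
  by have := pair_small_gain_le k l ca cb; rewrite /= !xsectionE.
rewrite ge0_integralZl//; last exact: measurable_funTS.
rewrite (_ : 9 * _ * _ = phi ^+ 2 * C * (phi * 9)); last by ring.
rewrite [leRHS]EFinM lee_wpmul2l//.
apply: le_trans (nonneg_integral_dominated_le mcube phi0 (@distribution_le j) mgap _) _ => //.
by rewrite EFinM lee_wpmul2l ?lee_fin// integral_inve_gap_le.
Qed.

Lemma small_gain_prob_le (q : quad 'I_n) : quad_uniq q ->
  (P [set w | small_gain eps (quad_map (X^~ w) q)] <= (9 * phi ^+ 3 * C)%:E)%E.
Proof.
case: q => i [j [k l]] uq; have [_ _ _ indX] := pX.
rewrite (joint_law4 indX uq); last exact: measurable_small_gain.
rewrite -[leRHS]mule1 -(probability_setT (distribution P (X i))).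
apply: nonneg_integral_le_cst => // b _; rewrite triple_small_gain_le andbT.
by do 2![apply: integral_ge0 => ? _].
Qed.

End small_gain_probability.

(** * Tours *)

Section doubleton.
Variable T : finType.
Implicit Types a b c e : T.

Lemma set2_eq a b c e :
  ([set a; b] == [set c; e])%SET = (a == c) && (b == e) || (a == e) && (b == c).
Proof.
apply/eqP/orP => [E|[]/andP[/eqP-> /eqP->]//]; last by rewrite finset.setUC.
have : a \in [set c; e]%SET by rewrite -E set21.
rewrite !inE => /orP[]/eqP ae; rewrite ae eqxx /=; [left|right].
  have : e \in [set c; b]%SET by rewrite -ae E set22.
  have : b \in [set c; e]%SET by rewrite -E set22.
  by rewrite !inE => /orP[/eqP->|//]; rewrite orbb eq_sym.
have : c \in [set e; b]%SET by rewrite -ae E set21.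
have : b \in [set c; e]%SET by rewrite -E set22.
by rewrite !inE => /orP[//|/eqP->]; rewrite orbb eq_sym.
Qed.

Lemma big_set_exchange (V : zmodType) (F : T -> V) (E S S' : {set T}) :
  S \subset E -> (forall i, i \in S' -> i \notin E) ->
  \sum_(i in E :\: S :|: S') F i =
  \sum_(i in E) F i - \sum_(i in S) F i + \sum_(i in S') F i.
Proof.
move=> SE S'E; rewrite [in RHS](big_setID S)/= (finset.setIidPr SE).
rewrite (addrC (\sum_(i in S) _)) addrK.
rewrite (big_setID S')/= addrC; congr (_ + _); apply: eq_bigl => i.
  rewrite !inE; case: (boolP (i \in S')) => //= iS'.
    by rewrite (negbTE (S'E _ iS')) andbF.
  by rewrite orbF.
by rewrite !inE; case: (i \in S'); rewrite ?andbF ?orbT ?orbF.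
Qed.

End doubleton.

Section tours.
Context {n : nat}.
Implicit Type t : @tour n.

Lemma mem_tour t u : u \in tour_tuple t.
Proof.
have := uniq_min_size (tour_uniq t) (s2 := enum 'I_n).
rewrite -cardE card_ord [X in (_ <= X)%N]size_tuple leqnn.
by move=> /(_ _ isT)[v|_ ->]; rewrite mem_enum.
Qed.

Lemma next_inj t : injective (next t).
Proof. exact: can_inj (prev_next (tour_uniq t)). Qed.

Lemma order_next t u : fingraph.order (next t) u = n.
Proof.
have := order_cycle (cycle_next (tour_uniq t)) (tour_uniq t) (mem_tour t u).
by rewrite size_tuple.
Qed.

Lemma next_next_neq t u : (2 < n)%N -> next t (next t u) != u.
Proof.
move=> n2; have := orbit_uniq (next t) u; rewrite /orbit order_next.
case: n n2 t u => [|[|[|m]]]// _ t u /=.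
by rewrite !inE !negb_or => /andP[/and3P[_ + _] _]; rewrite eq_sym.
Qed.

Lemma mem_tour_edges t u v :
  ([set u; v]%SET \in tour_edges t) = (next t u == v) || (next t v == u).
Proof.
apply/imsetP/orP => [[w _ /eqP]|[]/eqP nuv].
- by rewrite set2_eq => /orP[]/andP[/eqP-> /eqP->]; [left|right].
- by exists u => //; rewrite nuv.
- by exists v => //; rewrite nuv finset.setUC.
Qed.

Lemma tour_edge_inj t : (2 < n)%N -> injective (fun u => [set u; next t u]%SET).
Proof.
move=> n2 u v /eqP; rewrite set2_eq => /orP[/andP[/eqP//]|/andP[/eqP uv /eqP vu]].
by have := next_next_neq t u n2; rewrite vu -uv eqxx.
Qed.

End tours.

Section tour_lengths.
Context {R : realType} {n d : nat}.
Variable x : 'I_n -> Rpoint R d.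
Implicit Type t : @tour n.

Lemma dist2C (p q : Rpoint R d) : dist2 p q = dist2 q p.
Proof. by congr Num.sqrt; apply: eq_bigr => j _; rewrite -sqrrN opprB. Qed.

Lemma dist2xx (p : Rpoint R d) : dist2 p p = 0.
Proof. by rewrite /dist2 big1 ?sqrtr0// => j _; rewrite subrr expr0n. Qed.

Definition edge_length (e : {set 'I_n}) : R :=
  (\sum_(u in e) \sum_(v in e) dist2 (x u) (x v)) / 2.

Lemma edge_length_set2 u v : edge_length [set u; v]%SET = dist2 (x u) (x v).
Proof.
rewrite /edge_length; have [->|uv] := eqVneq u v.
  by rewrite finset.setUid !big_set1 dist2xx mul0r.
have sum2 (F : 'I_n -> R) : \sum_(w in [set u; v]%SET) F w = F u + F v.
  by rewrite big_setU1 ?inE//= big_set1.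
by rewrite !sum2 !dist2xx add0r addr0 (dist2C (x v)); field.
Qed.

Lemma tour_length_edges t : (2 < n)%N ->
  tour_length x t = \sum_(e in tour_edges t) edge_length e.
Proof.
move=> n2; rewrite /tour_edges big_imset/=; last by move=> u v _ _; exact: tour_edge_inj.
by apply: eq_big => // u _; rewrite edge_length_set2.
Qed.

Lemma tour_length_two_change t t' : two_change t t' ->
  exists2 q : quad 'I_n, quad_uniq q &
    tour_length x t - tour_length x t' = two_change_gain (quad_map x q).
Proof.
case/existsP => u1 /existsP[u2 /existsP[v1 /existsP[v2]]].
case/and4P => uq /eqP nu /eqP nv /eqP edges_t'.
have quq : quad_uniq (v1, (u2, (u1, v2))).
  by rewrite /quad_uniq -[X in uniq X]/(rot 1 (rev [:: u1; u2; v1; v2])) rot_uniq rev_uniq.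
have n2 : (2 < n)%N by have := ltnW (quad_uniq_card quq); rewrite card_ord.
exists (v1, (u2, (u1, v2))) => //.
move: uq; rewrite /= !inE !negb_or -!andbA andbT.
case/and5P => u12 u1v1 u1v2 u2v1 /andP[u2v2 v12].
have removed : [set [set u1; u2]; [set v1; v2]]%SET \subset tour_edges t.
  by rewrite finset.subUset !finset.sub1set !mem_tour_edges nu nv !eqxx.
have added e : e \in [set [set u1; v1]; [set u2; v2]]%SET -> e \notin tour_edges t.
  rewrite !inE => /orP[]/eqP->; rewrite mem_tour_edges negb_or.
    by rewrite nu nv u2v1 eq_sym.
  by rewrite -[in X in X && _]nv -nu !(inj_eq (@next_inj n t)) nu u2v1 eq_sym.
rewrite !tour_length_edges// edges_t' big_set_exchange//.
rewrite !big_setU1 ?big_set1 ?inE ?set2_eq ?(negbTE u1v1) ?(negbTE u1v2) ?(negbTE u12)//=.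
rewrite !edge_length_set2 /two_change_gain /distance_difference /=.
by rewrite (dist2C (x v2) (x u2)) (dist2C (x v2) (x v1)); ring.
Qed.

Lemma path_potential_drop (T : Type) (e : rel T) (h : T -> R) (delta : R) s r :
  (forall s s', e s s' -> delta < h s - h s') -> path e s r -> (0 < size r)%N ->
  delta * (size r)%:R < h s - h (last s r).
Proof.
move=> e_drop; elim: r s => // s' [|s'' r] IH s.
  by rewrite /= andbT mulr1 => /e_drop.
move=> /= /andP[/e_drop ss' ps'] _; have := IH s' ps' isT.
by rewrite /= -[X in _ -> delta * X < _]natr1 mulrDr mulr1 => ?; lra.
Qed.

Lemma size_path_improving t r : path (improving x) t r -> (size r <= n ^ n)%N.
Proof.
move=> ptr; pose len (s : n.-tuple 'I_n) : R := \sum_(u < n) dist2 (x u) (x (next s u)).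
have decreasing : sorted (fun a b : R => b < a) (map len (map (@tour_tuple n) r)).
  apply: (@path_sorted _ _ (tour_length x t)); rewrite -map_comp path_map.
  by apply: sub_path ptr => s s' /andP[].
have uniq_r : uniq (map (@tour_tuple n) r).
  apply/(@map_uniq _ _ len)/(sorted_uniq _ _ decreasing); last exact: ltxx.
  by move=> a b c ba cb; exact: lt_trans ba.
rewrite -(size_map (@tour_tuple n)) -(card_uniqP uniq_r).
by apply: leq_trans (max_card _) _; rewrite card_tuple card_ord.
Qed.

Lemma tour_length_ge0 t : 0 <= tour_length x t.
Proof. by apply: sumr_ge0 => u _; exact: sqrtr_ge0. Qed.

Lemma tour_length_unit_cube_le t : (forall i, unit_cube (x i)) ->
  tour_length x t <= n%:R * Num.sqrt d%:R.
Proof.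
move=> cx; rewrite mulr_natl -[n in leRHS]card_ord -sumr_const.
by apply: ler_sum => u _; apply: ler_wsqrtr; exact: sqdist_unit_cube_le.
Qed.

Lemma path_improving_small_gain t r k : (forall i, unit_cube (x i)) ->
  path (improving x) t r -> (k < size r)%N ->
  exists2 q, quad_uniq q & small_gain (n%:R * Num.sqrt d%:R / k.+1%:R) (quad_map x q).
Proof.
move=> cx ptr kr; set L := n%:R * Num.sqrt d%:R; apply: contrapT => no_small_gain.
have steps_large s s' : improving x s s' ->
    L / k.+1%:R < tour_length x s - tour_length x s'.
  move=> /andP[/tour_length_two_change[q uq gainE] lt_len].
  rewrite ltNge; apply/negP => gain_small; apply: no_small_gain; exists q => //; split.
    by do 3?split; exact: cx.
  by rewrite /= in_itv/= -gainE subr_gt0 lt_len.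
have := path_potential_drop steps_large ptr (leq_ltn_trans (leq0n k) kr).
apply/negP; rewrite -leNgt; apply: (@le_trans _ _ L).
  by rewrite lerBlDr (le_trans (tour_length_unit_cube_le t cx))// lerDl tour_length_ge0.
by rewrite mulrAC ler_pdivlMr ?ltr0n// ler_wpM2l ?mulr_ge0 ?sqrtr_ge0// ler_nat.
Qed.

Lemma two_opt_steps_unit_cube_le : (forall i, unit_cube (x i)) ->
  (two_opt_steps x <= \sum_(k < n ^ n) \sum_(q : quad 'I_n | quad_uniq q)
    (\1_(small_gain (n%:R * Num.sqrt d%:R / k.+1%:R)) (quad_map x q))%:E)%E.
Proof.
move=> cx; apply: ge_ereal_sup => _ [t [r [[ptr _] ->]]].
rewrite (_ : size r = \sum_(k < n ^ n) (k < size r)%N)%N; last first.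
  transitivity (\sum_(k < n ^ n | (k < size r)%N) 1)%N; last exact: big_mkcond.
  by rewrite -(big_ord_widen _ (fun=> 1%N) (size_path_improving ptr)) sum1_card card_ord.
rewrite natr_sum -sumEFin; apply: lee_sum => k _.
case: ltnP => [kr|_]; last exact: sume_ge0.
have [q uq gain_q] := path_improving_small_gain cx ptr kr.
by rewrite (bigD1 q)//= indicE mem_set// leeDl// sume_ge0.
Qed.

End tour_lengths.

(** * The expected number of steps *)

Section expected_steps.
Context {R : realType} {n d : nat} {disp : measure_display}
  {Omega : measurableType disp} (P : probability Omega R).
Local Notation point := (Rpoint R d.+2).
Variables (phi : R) (f : 'I_n -> point -> R) (X : 'I_n -> {RV P >-> point}).
Hypothesis pX : perturbed_instance phi f X.

Let L : R := n%:R * Num.sqrt d.+2%:R.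
Let H : R := series harmonic (n ^ n)%N.

Lemma expected_two_opt_steps_le_sum_prob :
  (\int[P]_w two_opt_steps (X^~ w) <=
   \sum_(k < n ^ n) \sum_(q : quad 'I_n | quad_uniq q)
     P [set w | small_gain (L / k.+1%:R) (quad_map (X^~ w) q)])%E.
Proof.
rewrite pair_big -big_filter; apply: integral_le_sum_measure.
  move=> [k q]; apply: (measurable_preimage _ (measurable_small_gain _)).
  by do 3![apply: measurable_fun_pair => //].
have Xcube : {ae P, forall w, forall i, unit_cube (X i w)}.
  by apply: filter_forall => i; case: pX => _ _ /(_ i)/ae_unit_cube.
apply: filterS Xcube => w Xw; apply: le_trans (two_opt_steps_unit_cube_le Xw) _.
by rewrite pair_big -big_filter.
Qed.

Lemma expected_two_opt_steps_le0 : (n < 4)%N ->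
  (\int[P]_w two_opt_steps (X^~ w) <= 0)%E.
Proof.
move=> n4; apply: le_trans expected_two_opt_steps_le_sum_prob _.
rewrite big1// => k _; apply: big_pred0 => q; apply/negP => /quad_uniq_card.
by rewrite card_ord leqNgt n4.
Qed.

Lemma expected_two_opt_steps_le_harmonic : (0 < n)%N -> 1 <= phi ->
  (\int[P]_w two_opt_steps (X^~ w) <=
   (504 * Num.sqrt d.+2%:R ^+ 4 * phi ^+ 3 * n%:R ^+ 5 * (H * (1 + 14 * H)))%:E)%E.
Proof.
move=> n0 phi1; set S : R := Num.sqrt _.
have S1 : 1 <= S by rewrite -[leLHS]sqrtr1 ler_wsqrtr// ler1n.
have L1 : 1 <= L by rewrite -[leLHS]mulr1 ler_pM// ler1n.
have H0 : 0 <= H by exact: series_harmonic_ge0.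
pose B k : R := 504 * S ^+ 3 * phi ^+ 3 * (1 + 14 * H) * L * harmonic k.
have B0 k : 0 <= B k.
  by rewrite !mulr_ge0 ?ler0n ?harmonic_ge0 ?exprn_ge0//; lra.
apply: le_trans expected_two_opt_steps_le_sum_prob _.
apply: (@le_trans _ _ (\sum_(k < n ^ n) (n%:R ^+ 4 * B k)%:E)%E).
  apply: lee_sum => k _.
  apply: (@le_trans _ _ (\sum_(q : quad 'I_n | quad_uniq q) (B k)%:E)%E).
    apply: lee_sum => q uq.
    have eps0 : 0 < L / k.+1%:R by rewrite divr_gt0// (lt_le_trans ltr01).
    have epsN : 1 <= L / k.+1%:R * (n ^ n)%:R.
      by rewrite mulrAC ler_pdivlMr// mul1r -[leLHS]mul1r ler_pM// ler_nat ltn_ord.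
    rewrite (le_trans (small_gain_prob_le phi1 pX eps0 epsN uq))// lee_fin.
    by rewrite -/S -/H [leLHS](_ : _ = B k)// /B /=; ring.
  rewrite sumEFin lee_fin sumr_const -[leLHS]mulr_natl ler_wpM2r//.
  by rewrite -natrX ler_nat (leq_trans (max_card _))// !card_prod card_ord !expnS expn0 muln1.
rewrite sumEFin lee_fin -mulr_sumr -mulr_sumr.
rewrite -(big_mkord xpredT (fun k => harmonic k)) -[\sum_(0 <= _ < _) _]/H /L -/S.
by rewrite le_eqVlt; apply/orP; left; apply/eqP; ring.
Qed.

End expected_steps.

Section logarithmic_bounds.
Context {R : realType}.
Implicit Type n : nat.

Lemma mulr_ln_ge1 n : (1 < n)%N -> 1 <= n%:R * ln n%:R :> R.
Proof.
move=> n1; have n2 : 2 <= n%:R :> R by rewrite ler_nat.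
have : 2^-1 <= ln n%:R :> R.
  apply: le_trans (harmonicS_le_lnB 0) _.
  by rewrite ln1 subr0 ler_ln ?posrE ?ltr0n ?ler_nat// ltnW.
by move=> half_ln; nra.
Qed.

Lemma series_harmonic_expn_le n : (1 < n)%N ->
  series harmonic (n ^ n)%N <= 2 * (n%:R * ln n%:R) :> R.
Proof.
move=> n1; have n0 := ltnW n1; have l1 := mulr_ln_ge1 n1.
have -> : 2 * (n%:R * ln n%:R) = n%:R * ln n%:R + ln (n ^ n)%:R :> R.
  by rewrite natrX lnXn ?ltr0n// -mulr_natl; ring.
by apply: le_trans (series_harmonic_le_ln _) _; rewrite ?expn_gt0 ?n0// lerD2r.
Qed.

End logarithmic_bounds.

Theorem theorem6 (R : realType) (d : nat) (hd : (2 <= d)%N) :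
  exists C : R, forall (n : nat) (phi : R), (0 < n)%N -> 1 <= phi ->
    forall (disp : measure_display) (Omega : measurableType disp)
      (P : probability Omega R)
      (f : 'I_n -> Rpoint R d -> R) (X : 'I_n -> {RV P >-> Rpoint R d}),
    perturbed_instance phi f X ->
    (\int[P]_w two_opt_steps (fun i => X i w)
       <= (C * n%:R ^+ 7 * ln n%:R ^+ 2 * phi ^+ 3)%:E)%E.
Proof.
case: d hd => [|[|d]]// _; pose B : R := 504 * Num.sqrt d.+2%:R ^+ 4.
exists (58 * B) => n phi n0 phi1 disp Omega P f X pX.
have B0 : 0 <= B by rewrite mulr_ge0 ?ler0n// exprn_ge0 ?sqrtr_ge0.
have phi0 : 0 <= phi by exact: le_trans phi1.
have [n1|n1] := leqP n 1.
  apply: le_trans (expected_two_opt_steps_le0 pX _) _; first exact: leq_ltn_trans n1 _.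
  have -> : ln n%:R = 0 :> R by rewrite (@anti_leq n 1) ?ln1// n1.
  by rewrite expr0n mulr0 mul0r.
apply: le_trans (expected_two_opt_steps_le_harmonic pX n0 phi1) _; rewrite lee_fin -/B.
have l1 : 1 <= n%:R * ln n%:R :> R by exact: mulr_ln_ge1.
have Hl : series harmonic (n ^ n)%N <= 2 * (n%:R * ln n%:R) :> R.
  exact: series_harmonic_expn_le.
have -> : 58 * B * n%:R ^+ 7 * ln n%:R ^+ 2 * phi ^+ 3 =
  B * phi ^+ 3 * n%:R ^+ 5 * (58 * (n%:R * ln n%:R) ^+ 2) by ring.
rewrite ler_wpM2l//; first by rewrite (mulr_ge0 (mulr_ge0 B0 _)) ?exprn_ge0.
by have := series_harmonic_ge0 (R := R) (n ^ n)%N; nra.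
Qed.
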